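(* Let $f:(\mathbf{R}^n,0)\to(\mathbf{R}^n,0)$ be a semialgebraic homeomorphism (germ) such that $f^{-1}$ is blow-analytic. Let $k\in\{1,2,\ldots\}\cup\{\infty,\omega\}$. If $f$ is $C^k$, then $f^{-1}$ is $C^k$.
   Context: All maps $(\mathbf{R}^n,0)\to(\mathbf{R}^n,0)$ are germs at the origin; a property holds for the germ if it holds for some representative on a sufficiently small neighbourhood of $0$. A homeomorphism germ $f:(\mathbf{R}^n,0)\to(\mathbf{R}^n,0)$ is a homeomorphism between open neighbourhoods of $0$ with $f(0)=0$; it is semialgebraic if its graph is semialgebraic. $C^\omega$ means real analytic. A map $f:M\to N$ between real analytic manifolds is blow-analytic if there is a map $\pi:\widetilde M\to M$ which is a locally finite composition of blowings-up with nonsingular nowhere dense centers such that $f\circ\pi$ is real analytic. *)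

(* Defs.v *)
From HB Require Import structures.
From mathcomp Require Import all_boot all_order all_algebra.
From mathcomp Require Import all_classical all_reals all_analysis.
From mathcomp Require mpoly.

Set Implicit Arguments.
Unset Strict Implicit.
Unset Printing Implicit Defensive.

Import Order.TTheory GRing.Theory Num.Theory.
Import numFieldNormedType.Exports.

Local Open Scope classical_set_scope.
Local Open Scope ring_scope.

Definition poly_eval (R : realType) (n : nat) (p : mpoly.mpoly n R)
  (x : 'rV[R]_n) : R := mpoly.meval (fun i => x ord0 i) p.

(* A finite union of sets [p_1 = ... = p_a = 0, q_1 > 0, ..., q_b > 0]. *)
Definition semialgebraic (R : realType) (n : nat) (A : set 'rV[R]_n) : Prop :=
  exists s : seq (seq (mpoly.mpoly n R) * seq (mpoly.mpoly n R)),
    A = [set x | has (fun d => all (fun p => poly_eval p x == 0) d.1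
                            && all (fun q => 0 < poly_eval q x) d.2) s].

Definition graph_on (R : realType) (n m : nat) (U : set 'rV[R]_n)
  (f : 'rV[R]_n -> 'rV[R]_m) : set 'rV[R]_(n + m) :=
  [set row_mx x (f x) | x in U].

(* The sum over the multi-indices [al] in [nat^n] with [|al| = k]. *)
Definition homog_sum (R : realType) (n k : nat) (F : ('I_n -> nat) -> R) : R :=
  \sum_(al : {ffun 'I_n -> 'I_k.+1} | (\sum_i (al i : nat))%N == k)
    F (fun i => al i).

Definition monom (R : realType) (n : nat) (h : 'rV[R]_n) (al : 'I_n -> nat) : R :=
  \prod_i h ord0 i ^+ al i.

(* Near [a], each component is the sum of an absolutely convergent power
   series; since the convergence is absolute, the terms may be grouped by
   total degree. *)
Definition real_analytic_at (R : realType) (n m : nat)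
  (f : 'rV[R]_n -> 'rV[R]_m) (a : 'rV[R]_n) : Prop :=
  forall j : 'I_m, exists (c : ('I_n -> nat) -> R) (r : R), 0 < r /\
    forall h : 'rV[R]_n, (forall i, `|h ord0 i| < r) ->
      cvgn (series (fun k => homog_sum k (fun al => `|c al * monom h al|))) /\
      series (fun k => homog_sum k (fun al => c al * monom h al)) @ \oo
        --> f (a + h) ord0 j.

Definition continuous_on (S T : topologicalType) (U : set S) (f : S -> T) :
  Prop := forall x, U x -> {for x, continuous f}.

(* All partial derivatives of order at most [k] exist and are continuous on the
   open set [U]. *)
Fixpoint Ck_on (R : realType) (n m k : nat) (U : set 'rV[R]_n)
  (f : 'rV[R]_n -> 'rV[R]_m) : Prop :=
  match k with
  | 0 => continuous_on U f
  | k'.+1 => continuous_on U f /\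
      forall i : 'I_n, let e : 'rV[R]_n := delta_mx ord0 i in
        (forall x, U x -> derivable f x e) /\ Ck_on k' U ('D_e f)
  end.

Inductive smoothness : Type := Cfin of nat | Cinfty | Comega.

Definition C_on (R : realType) (n m : nat) (k : smoothness) (U : set 'rV[R]_n)
  (f : 'rV[R]_n -> 'rV[R]_m) : Prop :=
  match k with
  | Cfin k' => Ck_on k' U f
  | Cinfty => forall k', Ck_on k' U f
  | Comega => forall x, U x -> real_analytic_at f x
  end.

Record chart (R : realType) (n : nat) (T : topologicalType) := Chart {
  cdom : set T;
  cmap :> T -> 'rV[R]_n
}.

(* [cmap c] is a homeomorphism from the open set [cdom c] onto an open set; its
   values outside [cdom c] are irrelevant. *)
Definition is_chart (R : realType) (n : nat) (T : topologicalType)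
  (c : chart R n T) : Prop :=
  [/\ open (cdom c),
      forall p q, cdom c p -> cdom c q -> c p = c q -> p = q,
      continuous_on (cdom c) c &
      forall O, open O -> O `<=` cdom c -> open (c @` O)].

(* Read in the charts [c] and [d], the map [f] is real analytic at [p]. *)
Definition analytic_read (R : realType) (n m : nat) (S T : topologicalType)
  (c : chart R n S) (d : chart R m T) (f : S -> T) (p : S) : Prop :=
  exists t : 'rV[R]_n -> 'rV[R]_m,
    real_analytic_at t (c p) /\ \forall q \near p, t (c q) = d (f q).

Definition compatible (R : realType) (n : nat) (T : topologicalType)
  (c d : chart R n T) : Prop :=
  forall p, cdom c p -> cdom d p -> analytic_read c d id p.

Record manifold (R : realType) (n : nat) := Manifold {
  mcarrier :> topologicalType;
  atlas : set (chart R n mcarrier);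
  m_hausdorff : hausdorff_space mcarrier;
  m_second_countable : @second_countable mcarrier;
  m_cover : forall p, exists2 c, atlas c & cdom c p;
  m_charts : forall c, atlas c -> is_chart c;
  m_compatible : forall c d, atlas c -> atlas d -> compatible c d
}.

(* Membership in the maximal atlas. *)
Definition analytic_chart (R : realType) (n : nat) (M : manifold R n)
  (c : chart R n M) : Prop :=
  is_chart c /\
  forall d, atlas d -> compatible c d /\ compatible d c.

Definition analytic_at (R : realType) (n m : nat) (M : manifold R n)
  (N : manifold R m) (f : M -> N) (p : M) : Prop :=
  {for p, continuous f} /\
  forall c d, atlas c -> atlas d -> cdom c p -> cdom d (f p) ->
    analytic_read c d f p.

Definition analytic_iso_on (R : realType) (n m : nat) (M : manifold R n)
  (N : manifold R m) (A : set M) (B : set N) (f : M -> N) : Prop :=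
  (forall p, A p -> B (f p) /\ analytic_at f p) /\
  exists h : N -> M,
    (forall p, A p -> h (f p) = p) /\
    (forall q, B q -> [/\ A (h q), analytic_at h q & f (h q) = q]).

(* On the domain of the analytic chart [c], the set [C] is the coordinate
   subspace where the first [k] coordinates vanish. *)
Definition adapted_chart (R : realType) (n : nat) (M : manifold R n)
  (C : set M) (c : chart R n M) (k : nat) : Prop :=
  [/\ analytic_chart c, (k <= n)%N &
      forall p, cdom c p ->
        (C p <-> forall i : 'I_n, (i < k)%N -> c p ord0 i = 0)].

Definition nonsingular (R : realType) (n : nat) (M : manifold R n)
  (C : set M) : Prop :=
  closed C /\
  forall a, C a -> exists (c : chart R n M) (k : nat),
    cdom c a /\ adapted_chart C c k.

Definition nowhere_dense (T : topologicalType) (C : set T) : Prop :=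
  interior (closure C) = set0.

(* [xi] is a vector of homogeneous coordinates, padded with zeros, of a point
   of the projective space P^(k-1), and the line it spans contains the first
   [k] coordinates of [x]. *)
Definition incident (R : realType) (n k : nat) (x xi : 'rV[R]_n) : Prop :=
  [/\ xi != 0,
      forall i : 'I_n, (k <= i)%N -> xi ord0 i = 0 &
      forall i j : 'I_n, (i < k)%N -> (j < k)%N ->
        x ord0 i * xi ord0 j = x ord0 j * xi ord0 i].

(* Over [cdom c], the map [b] is isomorphic to the projection to the first
   factor of
     { (x, [xi]) | x_i xi_j = x_j xi_i for i, j < k }  in  c(cdom c) x P^(k-1):
   [L p] is a choice of homogeneous coordinates of the second component of the
   image of [p], and the i-th chart is the affine chart
   (x_i; xi_j / xi_i for j < k, j != i; x_j for j >= k) on [xi_i != 0]. *)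
Definition blowup_model (R : realType) (n : nat) (M' M : manifold R n)
  (b : M' -> M) (c : chart R n M) (k : nat) : Prop :=
  exists L : M' -> 'rV[R]_n,
    [/\ forall p, cdom c (b p) -> incident k (c (b p)) (L p),
        forall q xi, cdom c q -> incident k (c q) xi ->
          exists! p, b p = q /\ exists t : R, L p = t *: xi &
        forall i : 'I_n, (i < k)%N -> analytic_chart
          (Chart [set p : M' | cdom c (b p) /\ L p ord0 i != 0]
            (fun p => \row_j (if (j < k)%N && (j != i)
                              then L p ord0 j / L p ord0 i
                              else c (b p) ord0 j)))].

(* [b] is the blowing-up of [M] with center [C]. The blowing-up is unique up to
   a unique isomorphism over [M], so it is characterized locally on [M]. *)
Definition blowup (R : realType) (n : nat) (M' M : manifold R n)
  (b : M' -> M) (C : set M) : Prop :=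
  analytic_iso_on (b @^-1` (~` C)) (~` C) b /\
  forall a, C a -> exists (c : chart R n M) (k : nat),
    [/\ cdom c a, adapted_chart C c k & blowup_model b c k].

(* The terms of the sequence of manifolds [M, X 0, X 1, X 2, ...]. *)
Definition stage (R : realType) (n : nat) (M : manifold R n)
  (X : nat -> manifold R n) (j : nat) : manifold R n :=
  if j is j'.+1 then X j' else M.

Fixpoint to_base (R : realType) (n : nat) (M : manifold R n)
  (X : nat -> manifold R n) (b : forall j, stage M X j.+1 -> stage M X j)
  (j : nat) : stage M X j -> M :=
  match j return stage M X j -> M with
  | 0 => fun x => x
  | j'.+1 => fun x => to_base b (b j' x)
  end.

(* [pi] is the composition of a sequence
     ... -> M_2 -> M_1 -> M_0 = M
   of blowings-up such that every point of [M] has a neighbourhood [W] over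
   which all centers but finitely many are empty; over [W] the source of [pi]
   is then M_j for every large [j]. A finite composition is the case where the
   remaining centers are empty. *)
Definition locally_finite_blowups (R : realType) (n : nat)
  (Mt M : manifold R n) (pi : Mt -> M) : Prop :=
  exists (X : nat -> manifold R n)
         (b : forall j, stage M X j.+1 -> stage M X j)
         (C : forall j, set (stage M X j))
         (p : forall j, Mt -> stage M X j),
    [/\ forall j, [/\ nonsingular (C j), nowhere_dense (C j) &
                      blowup (b j) (C j)],
        forall y, p 0%N y = pi y,
        forall j y, b j (p j.+1 y) = p j y &
        forall a : M, exists (W : set M) (J : nat), [/\ open W, W a &
          forall j, (J <= j)%N ->
            (forall x, C j x -> ~ W (to_base b x)) /\
            analytic_iso_on (pi @^-1` W) (@to_base R n M X b j @^-1` W) (p j)]].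

Definition blow_analytic (R : realType) (n m : nat) (M : manifold R n)
  (N : manifold R m) (f : M -> N) : Prop :=
  exists (Mt : manifold R n) (pi : Mt -> M),
    locally_finite_blowups pi /\ forall y, analytic_at (N := N) (f \o pi) y.

Lemma homog_sum_eq0 (R : realType) (n k : nat) (F : ('I_n -> nat) -> R) :
  (forall al, (\sum_i al i)%N = k -> F al = 0) -> homog_sum k F = 0.
Proof. by move=> F0; apply: big1 => al /eqP /F0. Qed.

Lemma homog_sum0 (R : realType) (n : nat) (F : ('I_n -> nat) -> R) :
  homog_sum 0 F = F (fun=> 0%N).
Proof.
have E (al : {ffun 'I_n -> 'I_1}) : (fun i => al i : nat) = (fun=> 0%N).
  by apply/funext => i; rewrite ord1.
rewrite /homog_sum (bigD1 [ffun=> ord0]) /=; last first.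
  by apply/eqP; rewrite big1// => i _; rewrite ffunE.
rewrite big1 ?addr0 ?E// => al /andP[_ /eqP]; case.
by apply/ffunP => i; rewrite !ord1.
Qed.

Lemma homog_sum1 (R : realType) (n : nat) (j : 'I_n)
  (F : ('I_n -> nat) -> R) : (forall al, al j != 1%N -> F al = 0) ->
  homog_sum 1 F = F (fun i => i == j : nat).
Proof.
move=> F0; rewrite /homog_sum.
rewrite (bigD1 [ffun i => if i == j then ord_max else ord0 : 'I_2]) /=; last first.
  rewrite (bigD1 j)//= ffunE eqxx big1 ?addn0// => i ij.
  by rewrite ffunE (negbTE ij).
rewrite big1 ?addr0 => [|al /andP[/eqP s1 aj]].
  by congr F; apply/funext => i; rewrite ffunE; case: eqP.
apply: F0; apply: contra aj => /eqP aj1; apply/eqP/ffunP => i.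
rewrite ffunE; case: (eqVneq i j) => [->|ij]; apply/val_inj => //=.
move: s1; rewrite (bigD1 j)//= aj1 add1n => -[] /eqP.
by rewrite sum_nat_eq0 => /forall_inP /(_ i ij) /eqP.
Qed.

Lemma cvg_series_le1 (R : realType) (u : nat -> R) :
  (forall k, (1 < k)%N -> u k = 0) -> series u @ \oo --> u 0%N + u 1%N.
Proof.
move=> u0; apply: cvg_near_cst; exists 2%N => // N /= N2.
rewrite /series /= (big_cat_nat (n := 2))//= [X in _ + X]big_nat_cond.
rewrite [X in _ + X]big1 ?addr0 => [|k /andP[/andP[k2 _] _]]; last exact: u0.
by rewrite big_nat_recr//= big_nat1.
Qed.

Lemma real_analytic_id (R : realType) (n : nat) (a : 'rV[R]_n) :
  real_analytic_at id a.
Proof.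
move=> j; pose c (al : 'I_n -> nat) : R :=
  if (\sum_i al i == 0)%N then a ord0 j
  else if (\sum_i al i == 1)%N && (al j == 1)%N then 1 else 0.
exists c, 1; split=> // h _.
have c2 k al : (1 < k)%N -> (\sum_i al i)%N = k -> c al = 0.
  by rewrite /c => k1 ->; case: k k1 => [//|[]].
have cd : c (fun i => i == j : nat) = 1.
  rewrite /c (bigD1 j)//= eqxx big1 => [//|i /negbTE -> //].
have md : monom h (fun i => i == j : nat) = h ord0 j.
  rewrite /monom (bigD1 j)//= eqxx expr1 big1 ?mulr1// => i /negbTE ->.
  by rewrite expr0.
split.
  apply/cvg_ex; eexists; apply: cvg_series_le1 => k k1.
  by apply: homog_sum_eq0 => al alk; rewrite (c2 k)// mul0r normr0.
suff -> : (a + h) ord0 j =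
    homog_sum 0 (fun al => c al * monom h al) +
    homog_sum 1 (fun al => c al * monom h al).
  apply: cvg_series_le1 => k k1.
  by apply: homog_sum_eq0 => al alk; rewrite (c2 k)// mul0r.
rewrite homog_sum0; pose F al := if al j == 1%N then c al * monom h al else 0.
have -> : homog_sum 1 (fun al => c al * monom h al) = homog_sum 1 F.
  apply: eq_bigr => al /eqP s1; rewrite /F; case: ifPn => // aj.
  by rewrite /c s1 /= (negbTE aj) mul0r.
rewrite (homog_sum1 (j := j)); last by move=> al; rewrite /F => /negbTE ->.
rewrite /F eqxx cd md mul1r mxE; congr (_ + _).
rewrite /c big1// eqxx /monom big1 ?mulr1// => i _.
Qed.

Lemma second_countable_rV (R : realType) (n : nat) :
  @second_countable 'rV[R]_n.
Proof.
pose box (ab : 'rV[rat]_n * 'rV[rat]_n) : set 'rV[R]_n :=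
  [set x | forall j, ratr (ab.1 ord0 j) < x ord0 j < ratr (ab.2 ord0 j)].
exists (range box); first exact: sub_countable (card_image_le _ _) (countableP _).
split=> [_ [ab _ <-]|x].
  rewrite openE => x xab.
  exists (fun _ j => `]ratr (ab.1 ord0 j), ratr (ab.2 ord0 j)[%classic).
    move=> i j; rewrite ord1; apply: open_nbhs_nbhs; split.
      exact: interval_open.
    by rewrite /= in_itv/=; exact: xab.
  by move=> y /= yab j; have := yab ord0 j; rewrite in_itv.
move=> A [P xP PA].
have H j : exists ab : rat * rat,
    ratr ab.1 < x ord0 j < ratr ab.2 /\
    `]ratr ab.1, ratr ab.2[%classic `<=` P ord0 j.
  have /nbhs_ballP[e /= e0 eP] := xP ord0 j.
  have /rat_in_itvoo[u] : x ord0 j - e < x ord0 j by rewrite ltrBlDr ltrDl.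
  have /rat_in_itvoo[v] : x ord0 j < x ord0 j + e by rewrite ltrDl.
  rewrite !in_itv/= => /andP[v1 v2] /andP[u1 u2]; exists (u, v) => /=.
  split; first by rewrite u2 v1.
  move=> y /=; rewrite in_itv/= => /andP[uy yv]; apply: eP.
  rewrite /ball /= ltr_distlC (lt_trans u1 uy)/=.
  exact: lt_trans yv v2.
have [ab abP] := choice H.
pose AB := (\row_j (ab j).1, \row_j (ab j).2).
exists (box AB).
  split; first by exists AB.
  by move=> j; rewrite !mxE; case: (abP j).
move=> y yAB; apply: PA => i j; rewrite ord1; case: (abP j) => _; apply.
by rewrite /= in_itv/=; have := yAB j; rewrite !mxE.
Qed.

Section single_chart.
Context (R : realType) (n : nat) (T : topologicalType) (phi : T -> 'rV[R]_n).
Hypotheses (phi_inj : injective phi) (phi_cont : continuous phi).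
Hypothesis phi_open : forall O, open O -> open (phi @` O).

Let c0 : chart R n T := Chart [set: T] phi.

Lemma single_hausdorff : hausdorff_space T.
Proof.
move=> p q pq; apply: phi_inj; apply: (@norm_hausdorff R 'rV[R]_n).
move=> A B pA qB.
have [y [Ay By]] := pq _ _ (phi_cont pA) (phi_cont qB).
by exists (phi y).
Qed.

Lemma single_second_countable : @second_countable T.
Proof.
have [B cB [Bo Bb]] := second_countable_rV R n.
exists [set phi @^-1` b | b in B]; first exact: sub_countable (card_image_le _ _) cB.
split=> [_ [b Bb' <-]|x A].
  by apply: open_comp (Bo _ Bb') => y _; exact: phi_cont.
rewrite nbhsE => -[W [oW Wx] WA].
have /Bb [b [Bb' bx] bO] : nbhs (phi x) (phi @` W).
  by apply: open_nbhs_nbhs; split; [exact: phi_open|exists x].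
exists (phi @^-1` b); first by split=> //; exists b.
by move=> y /bO [z Wz /phi_inj <-]; exact: WA.
Qed.

Lemma single_is_chart : is_chart c0.
Proof.
split=> /=; first exact: openT.
- by move=> p q _ _; exact: phi_inj.
- by move=> x _; exact: phi_cont.
- by move=> O oO _; exact: phi_open.
Qed.

Lemma single_compatible : compatible c0 c0.
Proof.
move=> p _ _; exists id; split; first exact: real_analytic_id.
exact: nearW.
Qed.

Definition single_chart_manifold : manifold R n.
Proof.
refine (@Manifold R n T [set c0] single_hausdorff single_second_countable
  _ _ _).
- by move=> p; exists c0.
- by move=> _ ->; exact: single_is_chart.
- by move=> _ _ -> ->; exact: single_compatible.
Defined.

End single_chart.

Lemma id_continuous_rV (R : realType) (n : nat) :
  continuous (@id 'rV[R]_n).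
Proof. by move=> x; exact: cvg_id. Qed.

Lemma id_open_rV (R : realType) (n : nat) (O : set 'rV[R]_n) :
  open O -> open (id @` O).
Proof. by rewrite image_id. Qed.

Lemma set_val_continuous (R : realType) (n : nat) (V : set 'rV[R]_n) :
  continuous (set_val : V -> 'rV[R]_n).
Proof. exact: initial_continuous. Qed.

Lemma set_val_open (R : realType) (n : nat) (V : set 'rV[R]_n) :
  open V -> forall O : set V, open O -> open (set_val @` O).
Proof.
move=> oV _ [B oB <-]; rewrite (_ : _ @` _ = B `&` V); first exact: openI.
apply/seteqP; split=> [_ [y By <-]|x [Bx Vx]].
  by split=> //; exact: set_valP.
by exists (SigSub (mem_set Vx)) => //=; rewrite set_valE.
Qed.

Definition euclidean (R : realType) (n : nat) : manifold R n :=
  single_chart_manifold (@inj_id 'rV[R]_n) (@id_continuous_rV R n)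
    (@id_open_rV R n).

Definition open_submanifold (R : realType) (n : nat) (V : set 'rV[R]_n)
  (oV : open V) : manifold R n :=
  single_chart_manifold (@val_inj _ _ V : injective set_val)
    (@set_val_continuous R n V) (set_val_open oV).

(* [f] and [g] represent a homeomorphism germ and its inverse; their values
   away from [0] are irrelevant. *)
Definition homeomorphism_germ (R : realType) (n : nat)
  (f g : 'rV[R]_n -> 'rV[R]_n) : Prop :=
  f 0 = 0 /\ exists U V : set 'rV[R]_n,
    [/\ [/\ open U, open V, U 0 & V 0],
        forall x, U x -> V (f x) /\ g (f x) = x,
        forall y, V y -> U (g y) /\ f (g y) = y,
        continuous_on U f & continuous_on V g].

Definition semialgebraic_germ (R : realType) (n m : nat)
  (f : 'rV[R]_n -> 'rV[R]_m) : Prop :=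
  exists U : set 'rV[R]_n, [/\ open U, U 0 & semialgebraic (graph_on U f)].

Definition blow_analytic_germ (R : realType) (n m : nat)
  (f : 'rV[R]_n -> 'rV[R]_m) : Prop :=
  exists (V : set 'rV[R]_n) (oV : open V), V 0 /\
    blow_analytic (M := open_submanifold oV) (N := euclidean R m)
      (f \o (set_val : V -> 'rV[R]_n)).

Definition C_germ (R : realType) (n m : nat) (k : smoothness)
  (f : 'rV[R]_n -> 'rV[R]_m) : Prop :=
  exists U : set 'rV[R]_n, [/\ open U, U 0 & C_on k U f].

(* Main.v *)
(* A blow-analytic map is real analytic along analytic arcs: an analytic arc
   lifts through every blowing-up, because along an arc the first k coordinates
   of an adapted chart have a common factor s^d, and dividing by it extends the
   direction of the lift across the center. In particular s |-> g (y + s v) is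
   differentiable at 0 for all y near 0 and all v. Since f is differentiable at
   g y, differentiating f (g (y + s v)) = y + s v at s = 0 gives
   v = w *m J, where J is the Jacobian matrix of f at g y; hence J is
   invertible. As g is a continuous inverse of f, the inverse function theorem,
   in the class C^k or in the real analytic class, applies.

   Real analyticity is handled through polynomials: a function is analytic iff
   it is a pointwise limit of polynomials whose successive differences are
   summable for the norm mnorm r p = sum of |p_m| r^|m|. This norm is
   submultiplicative, which gives composition, and the analytic inverse is the
   limit of a Picard iteration carried out on polynomials. *)
Require Import Defs.
From mathcomp Require Import all_boot all_order all_algebra.
From mathcomp Require Import all_classical all_reals all_analysis.
From mathcomp Require Import ring lra.
From mathcomp Require mpoly.
Import -(notations) mpoly.

Set Implicit Arguments.
Unset Strict Implicit.
Unset Printing Implicit Defensive.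

Import Order.TTheory GRing.Theory Num.Theory.
Import numFieldNormedType.Exports.

Local Open Scope classical_set_scope.
Local Open Scope ring_scope.

(** * A submultiplicative norm on polynomials *)

Section mnorm.
Context {R : realDomainType} {n : nat}.
Implicit Types (p q : mpoly n R) (r s : R) (m : multinom n).

(** The map x |-> x^3 is an analytic homeomorphism whose inverse is not differentiable, so what has
    to be excluded is a degenerate Jacobian. A blow-analytic map need not be differentiable, hence
    the chain rule cannot be applied to [f \o g] directly. It is applied to restrictions to lines,
    where [g] is analytic, and the directional derivatives found in this way already fill a left
    inverse of the Jacobian. In the class C^k no inverse has to be constructed: continuity of [g]
    turns invertibility of the Jacobian into differentiability of [g], and regularity is then gained
    one order at a time. In the analytic class the difficulty is the rearrangement of multiple
    series under substitution; approximating by polynomials replaces it with norm estimates on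
    finite sums. *)

Definition mnorm r p : R := \sum_(m <- msupp p) `|mcoeff m p| * r ^+ mdeg m.

(** The supports of sums and differences vary; over one common index list the norms of several
    polynomials can be compared termwise. *)
Lemma mnorm_widen (d : seq (multinom n)) r p : uniq d -> {subset msupp p <= d} ->
  mnorm r p = \sum_(m <- d) `|mcoeff m p| * r ^+ mdeg m.
Proof.
move=> ud sd; rewrite /mnorm [RHS](bigID (mem (msupp p)))/=.
rewrite [X in _ + X]big1 ?addr0 => [|m mp]; last first.
  by rewrite (memN_msupp_eq0 mp) normr0 mul0r.
rewrite -[RHS]big_filter; apply: perm_big; apply: uniq_perm.
- exact: msupp_uniq.
- exact: filter_uniq.
- by move=> m; rewrite mem_filter; case: (boolP (m \in msupp p)) => // /sd ->.
Qed.

Lemma mnorm_ge0 r p : 0 <= r -> 0 <= mnorm r p.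
Proof. by move=> r0; apply: sumr_ge0 => m _; rewrite mulr_ge0// exprn_ge0. Qed.

Lemma mnorm0 r : mnorm r 0 = 0.
Proof. by rewrite /mnorm msupp0 big_nil. Qed.

Lemma mnormD r p q : 0 <= r -> mnorm r (p + q) <= mnorm r p + mnorm r q.
Proof.
move=> r0; pose d := undup (msupp p ++ msupp q ++ msupp (p + q)).
have ud : uniq d by exact: undup_uniq.
rewrite !(@mnorm_widen d)//; last 3 first.
- by move=> m mp; rewrite mem_undup !mem_cat mp ?orbT.
- by move=> m mp; rewrite mem_undup !mem_cat mp ?orbT.
- by move=> m mp; rewrite mem_undup !mem_cat mp ?orbT.
rewrite -big_split/=; apply: ler_sum => m _.
by rewrite -mulrDl ler_wpM2r ?exprn_ge0// mcoeffD ler_normD.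
Qed.

Lemma mnormZ_le r c p : 0 <= r -> mnorm r (c *: p) <= `|c| * mnorm r p.
Proof.
move=> r0; rewrite (@mnorm_widen (msupp p)) ?msupp_uniq//; last exact: msuppZ_le.
rewrite /mnorm mulr_sumr; apply: ler_sum => m _.
by rewrite mcoeffZ normrM mulrA.
Qed.

Lemma mnormN r p : 0 <= r -> mnorm r (- p) = mnorm r p.
Proof.
have N q : 0 <= r -> mnorm r (- q) <= mnorm r q.
  by move=> r0; rewrite -scaleN1r (le_trans (mnormZ_le _ _ _))// normrN1 mul1r.
by move=> r0; apply/le_anti; rewrite N// -{1}[p]opprK N.
Qed.

Lemma mnorm_sum (I : Type) (e : seq I) (P : pred I) (F : I -> mpoly n R) r :
  0 <= r -> mnorm r (\sum_(i <- e | P i) F i) <= \sum_(i <- e | P i) mnorm r (F i).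
Proof.
move=> r0; elim/big_rec2: _ => [|i y x _ le_xy]; first by rewrite mnorm0.
by rewrite (le_trans (mnormD _ _ _))// lerD2l.
Qed.

Lemma mnormX r m : mnorm r (mpolyX R m) = r ^+ mdeg m.
Proof. by rewrite /mnorm msuppX big_seq1 mcoeffX eqxx normr1 mul1r. Qed.

Lemma mnormC r c : mnorm r (mpolyC n c) = `|c|.
Proof.
rewrite /mnorm msuppC; case: eqP => [->|_]; first by rewrite big_nil normr0.
by rewrite big_seq1 mcoeffC eqxx mdeg0 mulr1 mulr1.
Qed.

Lemma mnormM r p q : 0 <= r -> mnorm r (p * q) <= mnorm r p * mnorm r q.
Proof.
move=> r0; rewrite {1}(mpolyE p) mulr_suml (le_trans (mnorm_sum _ _ _ _))//.
rewrite /mnorm mulr_suml; apply: ler_sum => m _; rewrite -/(mnorm r _).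
rewrite -scalerAl (le_trans (mnormZ_le _ _ _))// -mulrA ler_wpM2l//.
rewrite {1}(mpolyE q) mulr_sumr (le_trans (mnorm_sum _ _ _ _))// mulr_sumr.
apply: ler_sum => m' _; rewrite -scalerAr (le_trans (mnormZ_le _ _ _))//.
by rewrite -mpolyXD mnormX mdegD exprD mulrCA.
Qed.

Lemma mnorm_coeff r p m : 0 <= r -> `|mcoeff m p| * r ^+ mdeg m <= mnorm r p.
Proof.
move=> r0; case: (boolP (m \in msupp p)) => mp; last first.
  by rewrite (memN_msupp_eq0 mp) normr0 mul0r mnorm_ge0.
rewrite /mnorm (bigD1_seq m) ?msupp_uniq//= lerDl.
by apply: sumr_ge0 => i _; rewrite mulr_ge0// exprn_ge0.
Qed.

Lemma meval_le r p (h : 'I_n -> R) : 0 <= r -> (forall i, `|h i| <= r) ->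
  `|meval h p| <= mnorm r p.
Proof.
move=> r0 hr; rewrite {1}(mpolyE p) raddf_sum/=.
rewrite (le_trans (ler_norm_sum _ _ _))//; apply: ler_sum => m _.
rewrite mevalZ normrM ler_wpM2l// mevalX normr_prod mdegE -prodrXr.
apply: ler_prod => i _; rewrite normr_ge0/= normrX lerXn2r// nnegrE//.
Qed.

Lemma mnorm_exp r s p k : 0 <= r -> mnorm r p <= s -> mnorm r (p ^+ k) <= s ^+ k.
Proof.
move=> r0 ps; have s0 : 0 <= s by rewrite (le_trans _ ps)// mnorm_ge0.
elim: k => [|k IHk]; first by rewrite !expr0 -mpolyC1 mnormC normr1.
rewrite !exprS (le_trans (mnormM _ _ _))// ler_pM//; exact: mnorm_ge0.
Qed.

(** [p ^+ k - q ^+ k] is [p - q] times a sum of [k] products of [k.-1] factors. For [k = 0] the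
    coefficient [k%:R] vanishes, so the truncated exponent is harmless. *)
Lemma mnorm_exp_lip r s t p q k : 0 <= r -> mnorm r p <= s -> mnorm r q <= s ->
  mnorm r (p - q) <= t ->
  mnorm r (p ^+ k - q ^+ k) <= (k%:R * s ^+ k.-1) * t.
Proof.
move=> r0 ps qs pqt; have s0 : 0 <= s by rewrite (le_trans _ ps)// mnorm_ge0.
have t0 : 0 <= t by rewrite (le_trans _ pqt)// mnorm_ge0.
rewrite subrXX mulrC (le_trans (mnormM _ _ _))// ler_pM ?mnorm_ge0//.
rewrite (le_trans (mnorm_sum _ _ _ _))//.
rewrite (@le_trans _ _ (\sum_(i < k) s ^+ k.-1))//; last first.
  by rewrite sumr_const card_ord mulr_natl.
apply: ler_sum => i _; rewrite (le_trans (mnormM _ _ _))//.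
rewrite -[in leRHS](@subnK i k.-1).
  by rewrite exprD ler_pM ?mnorm_ge0 ?mnorm_exp.
by rewrite -ltnS (ltn_predK (ltn_ord i)) ltn_ord.
Qed.

End mnorm.

Section mcomp.
Context {R : realDomainType} {n k : nat}.
Implicit Types (p : mpoly n R) (P Q : 'I_n -> mpoly k R).

Definition mcomp P p : mpoly k R := mmap (@mpolyC k R) P p.

Lemma mcompE P p :
  mcomp P p = \sum_(m <- msupp p) mcoeff m p *: \prod_i P i ^+ m i.
Proof. by apply: eq_bigr => m _; rewrite mul_mpolyC. Qed.

Lemma meval_mcomp P p (h : 'I_k -> R) :
  meval h (mcomp P p) = meval (fun i => meval h (P i)) p.
Proof.
rewrite mcompE [in RHS](mpolyE p) !raddf_sum/=; apply: eq_bigr => m _.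
rewrite !mevalZ mevalX rmorph_prod/=; congr (_ * _).
by apply: eq_bigr => i _; rewrite rmorphXn.
Qed.

Lemma mnorm_prod_exp P (m : multinom n) r s : 0 <= r -> 
  (forall i, mnorm r (P i) <= s) ->
  mnorm r (\prod_i P i ^+ m i) <= s ^+ mdeg m.
Proof.
move=> r0 Ps; rewrite mdegE -prodrXr.
have : 0 <= mnorm r (\prod_i P i ^+ m i) <= \prod_i s ^+ m i; last by case/andP.
elim/big_rec2: _ => [|i y x _ /andP[x0 xy]].
  by rewrite -mpolyC1 mnormC normr1 ler01 lexx.
rewrite mnorm_ge0//= (le_trans (mnormM _ _ _))// ler_pM ?mnorm_ge0//.
exact: mnorm_exp.
Qed.

(** Under substitution the bound [s] takes the place of the radius: a monomial of degree d becomes a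
    product of d factors of norm at most [s]. *)
Lemma mnorm_mcomp P p r s : 0 <= r -> (forall i, mnorm r (P i) <= s) ->
  mnorm r (mcomp P p) <= mnorm s p.
Proof.
move=> r0 Ps; rewrite mcompE (le_trans (mnorm_sum _ _ _ _))//.
apply: ler_sum => m _; rewrite (le_trans (mnormZ_le _ _ _))// ler_wpM2l//.
exact: mnorm_prod_exp.
Qed.

Lemma mnorm_prod_lip P Q (m : multinom n) r s t : 0 <= r -> 0 <= s -> 0 <= t ->
  (forall i, mnorm r (P i) <= s) -> (forall i, mnorm r (Q i) <= s) ->
  (forall i, mnorm r (P i - Q i) <= t) ->
  mnorm r (\prod_i P i ^+ m i - \prod_i Q i ^+ m i) <=
    (mdeg m)%:R * s ^+ (mdeg m).-1 * t.
Proof.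
move=> r0 s0 t0 Ps Qs PQt; rewrite mdegE.
(* The difference of two products is estimated from bounds on the partial products themselves, hence
   the simultaneous induction; [e] is the total exponent treated so far. *)
suff : [/\ mnorm r (\prod_i P i ^+ m i) <= s ^+ (\sum_i m i),
  mnorm r (\prod_i Q i ^+ m i) <= s ^+ (\sum_i m i) &
  mnorm r (\prod_i P i ^+ m i - \prod_i Q i ^+ m i) <=
    (\sum_i m i)%:R * s ^+ (\sum_i m i).-1 * t] by case.
elim/big_rec3: _ => [|i y e x _ [IH1 IH2 IH3]].
  by rewrite subrr mnorm0 !mul0r -mpolyC1 mnormC normr1.
split.
- by rewrite exprD (le_trans (mnormM _ _ _))// ler_pM ?mnorm_ge0 ?mnorm_exp.
- by rewrite exprD (le_trans (mnormM _ _ _))// ler_pM ?mnorm_ge0 ?mnorm_exp.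
rewrite (_ : _ - _ = P i ^+ m i * (x - y) + (P i ^+ m i - Q i ^+ m i) * y);
  last by rewrite mulrBr mulrBl addrA subrK.
rewrite (le_trans (mnormD _ _ _))//.
rewrite [leRHS](_ : _ = e%:R * (s ^+ (m i + e).-1 * t) +
    (m i)%:R * (s ^+ (m i + e).-1 * t)); last by rewrite natrD; ring.
rewrite lerD//; last first.
  rewrite (le_trans (mnormM _ _ _))//.
  rewrite (le_trans (ler_pM _ _ (mnorm_exp_lip (m i) r0 (Ps i) (Qs i) (PQt i)) IH2))//.
  - exact: mnorm_ge0.
  - exact: mnorm_ge0.
  case: (m i) => [|j]; first by rewrite !mul0r.
  by rewrite le_eqVlt; apply/orP; left; apply/eqP; rewrite addSn/= exprD; ring.
rewrite (le_trans (mnormM _ _ _))//.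
rewrite (le_trans (ler_pM _ _ (mnorm_exp (m i) r0 (Ps i)) IH3))//.
- exact: mnorm_ge0.
- exact: mnorm_ge0.
case: e {IH1 IH2 IH3} => [|e]; first by rewrite !mul0r mulr0.
by rewrite le_eqVlt; apply/orP; left; apply/eqP; rewrite addnS/= exprD; ring.
Qed.

End mcomp.

(** * Power series as sums of homogeneous polynomials *)

Section homogeneous.
Context {R : realDomainType} {n : nat}.
Implicit Types (p : mpoly n R) (m : multinom n).

Definition homogeneous k p := {in msupp p, forall m, mdeg m = k}.

(** For homogeneous parts the radius separates from the coefficients; the bounds on series are
    therefore stated with [mnorm 1] and explicit powers of the radius. *)
Lemma mnorm_homogeneous k p r : homogeneous k p ->
  mnorm r p = mnorm 1 p * r ^+ k.
Proof.
move=> pk; rewrite /mnorm mulr_suml; apply: eq_big_seq => m mp.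
by rewrite expr1n mulr1 pk.
Qed.

Lemma homogeneousZX k c m : mdeg m = k -> homogeneous k (c *: mpolyX R m).
Proof. by move=> mk m' /msuppZ_le; rewrite msuppX inE => /eqP ->. Qed.

Lemma homogeneousD k p q : homogeneous k p -> homogeneous k q ->
  homogeneous k (p + q).
Proof. by move=> pk qk m /msuppD_le; rewrite mem_cat => /orP[/pk|/qk]. Qed.

Lemma homogeneousZ k c p : homogeneous k p -> homogeneous k (c *: p).
Proof. by move=> pk m /msuppZ_le /pk. Qed.

Lemma homogeneous_sum k (I : Type) (e : seq I) (P : pred I) (F : I -> mpoly n R) :
  (forall i, P i -> homogeneous k (F i)) ->
  homogeneous k (\sum_(i <- e | P i) F i).
Proof.
move=> FP; apply: (big_ind (homogeneous k)) => //.
- by move=> m; rewrite msupp0.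
- exact: homogeneousD.
Qed.

Lemma mnorm_mcomp_lip k l (P Q : 'I_n -> mpoly l R) p r s t :
  homogeneous k p -> 0 <= r -> 0 <= s -> 0 <= t ->
  (forall i, mnorm r (P i) <= s) -> (forall i, mnorm r (Q i) <= s) ->
  (forall i, mnorm r (P i - Q i) <= t) ->
  mnorm r (mcomp P p - mcomp Q p) <= mnorm 1 p * (k%:R * s ^+ k.-1 * t).
Proof.
move=> pk r0 s0 t0 Ps Qs PQt; rewrite !mcompE -sumrB.
rewrite (le_trans (mnorm_sum _ _ _ _))// /mnorm mulr_suml.
rewrite !big_seq; apply: ler_sum => m mp; rewrite -/(mnorm r _).
rewrite -scalerBr (le_trans (mnormZ_le _ _ _))// expr1n mulr1 ler_wpM2l//.
by rewrite -(pk _ mp) mnorm_prod_lip.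
Qed.

End homogeneous.

(** Allows one enumeration of multi-indices to be exchanged for another: functions with bounded
    values, monomials of bounded degree, supports. *)
Lemma big_uniq_supp (R : nmodType) (T : eqType) (d1 d2 : seq T) (F : T -> R) :
  uniq d1 -> uniq d2 ->
  (forall m, F m != 0 -> (m \in d1) = (m \in d2)) ->
  \sum_(m <- d1) F m = \sum_(m <- d2) F m.
Proof.
move=> u1 u2 d12.
have E d : \sum_(m <- d) F m = \sum_(m <- d | F m != 0) F m.
  rewrite [LHS](bigID (fun m => F m != 0))/= [X in _ + X]big1 ?addr0// => m.
  by rewrite negbK => /eqP.
rewrite !E -!(big_filter _ (fun m => F m != 0)).
apply: perm_big; apply: uniq_perm; rewrite ?filter_uniq// => m.
by rewrite !mem_filter; case: (boolP (F m != 0)) => //= /d12.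
Qed.

(** * Sums over multi-indices as sums over monomials *)

Section homog_sum.
Context {R : realType} {n : nat}.
Implicit Types (F : multinom n -> R).

Definition multinom_of (al : 'I_n -> nat) : multinom n := Multinom [tuple al i | i < n].

Lemma multinom_ofE al i : multinom_of al i = al i.
Proof. exact: mnmE. Qed.

Lemma mdeg_multinom_of al : mdeg (multinom_of al) = (\sum_i al i)%N.
Proof. by rewrite mdegE; apply: eq_bigr => i _; rewrite multinom_ofE. Qed.

Lemma homog_sum_multinom F k (d : seq (multinom n)) : uniq d ->
  (forall m, mdeg m = k -> m \in d) ->
  homog_sum k (fun al => F (multinom_of al)) =
    \sum_(m <- d | mdeg m == k) F m.
Proof.
move=> ud kd; rewrite /homog_sum.
pose mn (al : {ffun 'I_n -> 'I_k.+1}) := multinom_of (fun i => al i).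
rewrite -big_filter -(big_map mn predT F) -[RHS]big_filter.
apply: big_uniq_supp.
- rewrite map_inj_uniq ?filter_uniq// ?index_enum_uniq// => al be E.
  apply/ffunP => i; apply/val_inj => /=.
  by have := congr1 (fun m : multinom n => m i) E; rewrite !multinom_ofE.
- exact: filter_uniq.
move=> m _; rewrite mem_filter.
apply/mapP/andP => [[al]|[/eqP mk md]].
  rewrite mem_filter => /andP[/eqP alk _] ->.
  by rewrite mdeg_multinom_of alk eqxx kd// mdeg_multinom_of.
have mi i : (m i < k.+1)%N.
  by rewrite ltnS -mk mdegE (bigD1 i)//= leq_addr.
exists [ffun i => Ordinal (mi i)].
  rewrite mem_filter mem_index_enum andbT; apply/eqP; rewrite -[RHS]mk mdegE.
  by apply: eq_bigr => i _; rewrite ffunE.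
by apply/mnmP => i; rewrite multinom_ofE ffunE.
Qed.

Definition multinoms_lt K : seq (multinom n) :=
  [seq val x | x <- enum {: bmultinom n K}].

Lemma multinoms_lt_uniq K : uniq (multinoms_lt K).
Proof. by rewrite map_inj_uniq ?enum_uniq//; exact: val_inj. Qed.

Lemma mem_multinoms_lt K m : (m \in multinoms_lt K) = (mdeg m < K)%N.
Proof.
apply/mapP/idP => [[x _ ->]|mK]; first exact: bmdeg.
by exists (BMultinom mK); rewrite ?mem_enum.
Qed.

Lemma sum_homog_sum F K :
  \sum_(0 <= k < K) homog_sum k (fun al => F (multinom_of al)) =
    \sum_(m <- multinoms_lt K) F m.
Proof.
transitivity (\sum_(k < K) \sum_(m <- multinoms_lt K | mdeg m == k) F m).
  rewrite big_mkord; apply: eq_bigr => k _; apply: homog_sum_multinom.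
    exact: multinoms_lt_uniq.
  by move=> m mk; rewrite mem_multinoms_lt mk.
rewrite (exchange_big_dep predT)//= !big_seq; apply: eq_bigr => m.
rewrite mem_multinoms_lt => mK.
by rewrite (big_pred1 (Ordinal mK))// => k; rewrite /= eq_sym.
Qed.

Lemma sum_multinoms_lt (p : mpoly n R) (G : R -> multinom n -> R) K :
  (forall m, G 0 m = 0) -> (msize p <= K)%N ->
  \sum_(m <- multinoms_lt K) G (mcoeff m p) m =
    \sum_(m <- msupp p) G (mcoeff m p) m.
Proof.
move=> G0 pK; apply: big_uniq_supp; rewrite ?multinoms_lt_uniq ?msupp_uniq// => m.
case: (boolP (m \in msupp p)) => [mp _|mp]; last first.
  by rewrite (memN_msupp_eq0 mp) G0 eqxx.
by rewrite mem_multinoms_lt (leq_trans _ pK)// msize_mdeg_lt.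
Qed.

Lemma homog_sum_le k (F G : ('I_n -> nat) -> R) : 
  (forall al, (\sum_i al i)%N = k -> F al <= G al) -> homog_sum k F <= homog_sum k G.
Proof. by move=> FG; apply: ler_sum => al /eqP /FG. Qed.

Lemma eq_homog_sum k (F G : ('I_n -> nat) -> R) :
  (forall al, (\sum_i al i)%N = k -> F al = G al) -> homog_sum k F = homog_sum k G.
Proof. by move=> FG; apply: eq_bigr => al /eqP /FG. Qed.

Lemma meval_multinom_of (h : 'rV[R]_n) al :
  meval (fun i => h ord0 i) (mpolyX R (multinom_of al)) = monom h al.
Proof. by rewrite mevalX; apply: eq_bigr => i _; rewrite multinom_ofE. Qed.

End homog_sum.

(* [real_analytic_at f a] is by definition [analytic_fun_at (fun x => f x ord0 j) a]
   for all [j]. *)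
Definition analytic_fun_at {R : realType} {n : nat} (u : 'rV[R]_n -> R) (a : 'rV[R]_n) :=
  exists (c : ('I_n -> nat) -> R) (r : R), 0 < r /\
    forall h : 'rV[R]_n, (forall i, `|h ord0 i| < r) ->
      cvgn (series (fun k => homog_sum k (fun al => `|c al * monom h al|))) /\
      series (fun k => homog_sum k (fun al => c al * monom h al)) @ \oo
        --> u (a + h).

Lemma poly_evalE (R : realType) n (p : mpoly n R) (h : 'rV[R]_n) :
  poly_eval p h = \sum_(m <- msupp p)
    mcoeff m p * meval (fun i => h ord0 i) (mpolyX R m).
Proof.
by rewrite /poly_eval [LHS]mevalE; apply: eq_bigr => m _; rewrite mevalX.
Qed.

(** * Analyticity through limits of polynomials *)

Section expansion.
Context {R : realType} {n : nat}.
Implicit Types (u : 'rV[R]_n -> R) (h : 'rV[R]_n).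

(** Working form of analyticity at the origin, with [H k] the homogeneous part of degree [k]. A
    bound [B] on all partial sums of the norms replaces absolute convergence, and the polydisc is
    closed so that estimates hold up to the radius [r]. *)
Definition expansion u (H : nat -> mpoly n R) (r B : R) :=
  [/\ 0 < r, forall k, homogeneous k (H k),
    forall K, \sum_(0 <= k < K) mnorm 1 (H k) * r ^+ k <= B &
    forall h, (forall i, `|h ord0 i| <= r) ->
      series (fun k => poly_eval (H k) h) @ \oo --> u h].

Lemma analytic_expansion u a : analytic_fun_at u a ->
  exists H r B, expansion (fun h => u (a + h)) H r B.
Proof.
move=> [c [r [r0 cr]]]; pose s := r / 2.
have s0 : 0 < s by rewrite divr_gt0.
have sr : s < r by rewrite /s ltr_pdivrMr// ltr_pMr// ltr1n.
pose H k : mpoly n R := \sum_(al : {ffun 'I_n -> 'I_k.+1} |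
  (\sum_i (al i : nat))%N == k) c (fun i => al i) *: mpolyX R (multinom_of (fun i => al i)).
have Hk k : homogeneous k (H k).
  apply: homogeneous_sum => al /eqP alk; apply: homogeneousZX.
  by rewrite mdeg_multinom_of.
(* Every monomial of degree k takes the value [s ^+ k] at [hs], so absolute convergence at this one
   point bounds the norms at radius [s]. Halving [r] keeps [hs] inside the open polydisc. *)
pose hs : 'rV[R]_n := const_mx s.
have hsr i : `|hs ord0 i| < r by rewrite mxE gtr0_norm.
have [cvs _] := cr _ hsr.
exists H, s, (limn (series (fun k => homog_sum k (fun al => `|c al * monom hs al|)))).
split=> // [K|h hs'].
  apply: le_trans (nondecreasing_cvgn_le _ cvs K); last first.
    apply: nondecreasing_series => k _ _; apply: sumr_ge0 => al _.
    exact: normr_ge0.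
  apply: ler_sum => k _; rewrite -mnorm_homogeneous//.
  rewrite (le_trans (mnorm_sum _ _ _ (ltW s0)))//; apply: ler_sum => al /eqP alk.
  rewrite (le_trans (mnormZ_le _ _ (ltW s0)))// normrM ler_wpM2l//.
  rewrite mnormX mdeg_multinom_of alk /monom.
  under eq_bigr do rewrite mxE.
  by rewrite prodrXr alk normrX gtr0_norm.
have [_] := cr h (fun i => le_lt_trans (hs' i) sr).
set v := (X in series X); rewrite (_ : v = fun k => poly_eval (H k) h)//.
apply/funext => k; rewrite /v /poly_eval raddf_sum/=; apply: eq_bigr => al _.
by rewrite mevalZ meval_multinom_of.
Qed.

(** The variation bound makes the polynomials Cauchy for the norm at radius [r], so each coefficient
    converges, and the limits are the coefficients of the power series. Pointwise convergence of [p]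
    then identifies its sum. *)
Lemma analytic_of_bounded_variation u a (p : nat -> mpoly n R) r B : 0 < r ->
  (forall K, \sum_(0 <= k < K) mnorm r (p k.+1 - p k) <= B) ->
  (forall h, (forall i, `|h ord0 i| <= r) ->
     (fun k => poly_eval (p k) h) @ \oo --> u (a + h)) ->
  analytic_fun_at u a.
Proof.
move=> r0 pB pu.
pose v := series (fun k => mnorm r (p k.+1 - p k)).
have cv : cvgn v.
  apply: nondecreasing_is_cvgn.
    by apply: nondecreasing_series => k _ _; apply: mnorm_ge0; exact: ltW.
  by exists B => _ [K _ <-]; exact: pB.
have pv i j : (i <= j)%N -> mnorm r (p j - p i) <= v j - v i.
  move=> ij; rewrite sub_series_geq// -(telescope_sumr _ ij).
  by rewrite mnorm_sum// ltW.
have vl j : v j <= limn v.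
  apply: nondecreasing_cvgn_le => //.
  by apply: nondecreasing_series => k _ _; apply: mnorm_ge0; exact: ltW.
have cauchy e : 0 < e -> exists I, forall i j, (I <= i)%N -> (I <= j)%N ->
    mnorm r (p j - p i) <= e.
  move=> e0; have /cvgrPdist_lt /(_ _ e0) [I _ vI] := cv.
  have V i j : (I <= i)%N -> (i <= j)%N -> mnorm r (p j - p i) <= e.
    move=> Ii ij; rewrite (le_trans (pv _ _ ij))//.
    have := vI _ Ii; rewrite /= ger0_norm ?subr_ge0// => /ltW; apply: le_trans.
    by rewrite lerD2r.
  exists I => i j Ii Ij; case/orP: (leq_total i j) => ij; first exact: V.
  by rewrite -(mnormN _ (ltW r0)) opprB V.
have cauchy_coeff m e : 0 < e -> exists I, forall i j, (I <= i)%N -> (I <= j)%N ->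
    `|mcoeff m (p j) - mcoeff m (p i)| <= e.
  move=> e0; have rm : 0 < r ^+ mdeg m by rewrite exprn_gt0.
  have [I pI] := cauchy (e * r ^+ mdeg m) (mulr_gt0 e0 rm).
  exists I => i j Ii Ij; rewrite -mcoeffB -(ler_pM2r rm).
  by rewrite (le_trans (mnorm_coeff _ _ (ltW r0)))// pI.
have cvc m : cvgn (fun i => mcoeff m (p i)).
  apply: cauchy_cvg; apply: cauchy_exP => e e0.
  have [I pI] := cauchy_coeff m (e / 2) (divr_gt0 e0 (ltr0n _ 2)).
  exists (mcoeff m (p I)); exists I => // i /= Ii.
  rewrite /ball/= (le_lt_trans (pI _ _ Ii (leqnn _)))//.
  by rewrite ltr_pdivrMr// ltr_pMr// ltr1n.
pose c m := limn (fun i => mcoeff m (p i)).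
(* The estimate is uniform in the finite list [d]: for each [j] the Cauchy bound controls the sum
   over [d], and a finite sum passes to the limit in [j]. *)
have tail e : 0 < e -> exists I, forall i d, uniq d -> (I <= i)%N ->
    \sum_(m <- d) `|c m - mcoeff m (p i)| * r ^+ mdeg m <= e.
  move=> e0; have [I pI] := cauchy _ e0; exists I => i d ud Ii.
  have cvS : (fun j => \sum_(m <- d) `|mcoeff m (p j) - mcoeff m (p i)| * r ^+ mdeg m) @ \oo
      --> \sum_(m <- d) `|c m - mcoeff m (p i)| * r ^+ mdeg m.
    apply: (cvg_big (@add_continuous R)) => m _.
    by apply: cvgMl; apply: cvg_norm; apply: cvgB; [exact: cvc|exact: cvg_cst].
  rewrite -(cvg_lim _ cvS)//; apply: limr_le; first by apply/cvg_ex; eexists; exact: cvS.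
  exists I => // j /= Ij; apply: le_trans (pI _ _ Ii Ij).
  pose d' := undup (d ++ msupp (p j - p i)).
  have dd' : {subset d <= d'} by move=> m md; rewrite mem_undup mem_cat md.
  rewrite (@mnorm_widen _ _ d') ?undup_uniq//; last first.
    by move=> m md; rewrite mem_undup mem_cat md orbT.
  rewrite [leRHS](bigID (mem d))/= -[X in X + _]big_filter.
  rewrite [X in X + _](_ : _ = \sum_(m <- d) `|mcoeff m (p j) - mcoeff m (p i)| * r ^+ mdeg m); last first.
    under [LHS]eq_bigr do rewrite mcoeffB.
    apply: perm_big; apply: uniq_perm; rewrite ?filter_uniq ?undup_uniq// => m.
    by rewrite mem_filter; case: (boolP (m \in d)) => // /dd' ->.
  by rewrite lerDl sumr_ge0// => m _; rewrite mulr_ge0// exprn_ge0// ltW.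
have monr h m : (forall i, `|h ord0 i| < r) ->
    `|meval (fun i => h ord0 i) (mpolyX R m)| <= r ^+ mdeg m.
  move=> hr; rewrite mevalX normr_prod mdegE -prodrXr; apply: ler_prod => i _.
  by rewrite normr_ge0/= normrX lerXn2r ?nnegrE ?(ltW r0)// ltW.
exists (fun al => c (multinom_of al)), r; split=> // h hr; split.
  apply: nondecreasing_is_cvgn.
    by apply: nondecreasing_series => k _ _; apply: sumr_ge0 => al _.
  have [I pI] := tail _ ltr01.
  exists (1 + mnorm r (p I)) => _ [K _ <-].
  rewrite /series/= (@le_trans _ _
    (\sum_(0 <= k < K) homog_sum k (fun al => (fun m => `|c m| * r ^+ mdeg m) (multinom_of al))))//.
    apply: ler_sum => k _; apply: homog_sum_le => al alk.
    by rewrite normrM ler_wpM2l// -meval_multinom_of; exact: monr.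
  rewrite (sum_homog_sum (fun m => `|c m| * r ^+ mdeg m)).
  rewrite (@le_trans _ _ (\sum_(m <- multinoms_lt K) `|c m - mcoeff m (p I)| * r ^+ mdeg m +
     \sum_(m <- multinoms_lt K) `|mcoeff m (p I)| * r ^+ mdeg m))//.
    rewrite -big_split/=; apply: ler_sum => m _.
    rewrite -mulrDl ler_wpM2r ?exprn_ge0 ?(ltW r0)//.
    by rewrite -{1}[c m](subrK (mcoeff m (p I))) ler_normD.
  rewrite lerD ?pI ?multinoms_lt_uniq//.
  pose d' := undup (multinoms_lt K ++ msupp (p I)).
  have dd' : {subset multinoms_lt K <= d'}.
    by move=> m md; rewrite mem_undup mem_cat md.
  rewrite (@mnorm_widen _ _ d') ?undup_uniq//; last first.
    by move=> m md; rewrite mem_undup mem_cat md orbT.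
  rewrite [leRHS](bigID (mem (multinoms_lt K)))/= -[X in X + _]big_filter.
  rewrite [X in X + _](_ : _ = \sum_(m <- multinoms_lt K) `|mcoeff m (p I)| * r ^+ mdeg m); last first.
    apply: perm_big; apply: uniq_perm; rewrite ?filter_uniq ?undup_uniq ?multinoms_lt_uniq// => m.
    by rewrite mem_filter; case: (boolP (m \in multinoms_lt K)) => // /dd' ->.
  by rewrite lerDl sumr_ge0// => m _; rewrite mulr_ge0// exprn_ge0// ltW.
apply/cvgrPdist_le => e e0.
have e2 : 0 < e / 2 by rewrite divr_gt0.
have [I pI] := tail _ e2.
have /cvgrPdist_le /(_ _ e2) [I' _ pI'] := pu h (fun i => ltW (hr i)).
pose i := maxn I I'.
(* From this order on the partial sums contain every monomial of [p i], so their distance to [p i]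
   is a sum of coefficient errors, bounded by [tail]. *)
exists (msize (p i)) => // K /= pK.
rewrite (splitr e) -(subrKA (poly_eval (p i) h)).
rewrite (le_trans (ler_normD _ _))// lerD//; first by apply: pI'; exact: leq_maxr.
rewrite /series/=.
under eq_bigr do under eq_homog_sum do rewrite -meval_multinom_of.
rewrite (sum_homog_sum (fun m => c m * meval (fun i => h ord0 i) (mpolyX R m))).
rewrite distrC poly_evalE.
rewrite -(sum_multinoms_lt (G := fun x m => x * meval (fun i => h ord0 i) (mpolyX R m)) _ pK); last by move=> m; rewrite mul0r.
rewrite -sumrB (le_trans (ler_norm_sum _ _ _))//.
apply: le_trans (pI i (multinoms_lt K) (multinoms_lt_uniq _) (leq_maxl _ _)).
by apply: ler_sum => m _; rewrite -mulrBl normrM ler_wpM2l// monr.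
Qed.

End expansion.

(** * The sup norm on row vectors and evaluation of homogeneous parts *)

Section rV_norm.
Context {R : realType} {n : nat}.
Implicit Types (h x : 'rV[R]_n).

Lemma rV_norm_leP h r : 0 <= r ->
  reflect (forall i, `|h ord0 i| <= r) (`|h| <= r).
Proof.
move=> r0; rewrite [`|h|]/Num.norm/= mx_normrE; apply: (iffP idP) => [H i|H].
  by apply: le_trans H; exact: (le_bigmax _ _ (ord0, i)).
by apply: bigmax_le => // -[i j] _; rewrite ord1; exact: H.
Qed.

Lemma rV_coord_le h i : `|h ord0 i| <= `|h|.
Proof. by have /rV_norm_leP := lexx `|h|; apply. Qed.

Lemma near_addP (P : set 'rV[R]_n) x : (\forall y \near x, P y) <->
  exists2 d, 0 < d & forall h, `|h| <= d -> P (x + h).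
Proof.
split=> [/nbhs_ballP[e /= e0 eP]|[d d0 dP]].
  exists (e / 2); first by rewrite divr_gt0.
  move=> h hd; apply: eP; rewrite -ball_normE/= opprD addrA subrr sub0r normrN.
  by rewrite (le_lt_trans hd)// ltr_pdivrMr// ltr_pMr// ltr1n.
apply/nbhs_ballP; exists d => //= y; rewrite -ball_normE/= => xy.
by rewrite -(subrK x y) addrC; apply: dP; rewrite distrC ltW.
Qed.

Lemma continuous_rVP (V : normedModType R) (f : 'rV[R]_n -> V) x :
  {for x, continuous f} <-> forall e, 0 < e -> exists2 d, 0 < d &
     forall h, `|h| <= d -> `|f x - f (x + h)| <= e.
Proof.
split=> [/(@cvgrPdist_le _ _ _ (nbhs x) (nbhs_filter x)) H e /H /near_addP //|H].
apply/(@cvgrPdist_le _ _ _ (nbhs x) (nbhs_filter x)) => e /H H'.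
exact/near_addP.
Qed.

Lemma cvg_rowP (v : nat -> 'rV[R]_n) x :
  (forall j, (fun k => v k ord0 j) @ \oo --> x ord0 j) -> v @ \oo --> x.
Proof.
move=> vx; apply/cvgrPdist_le => e e0; near=> k.
apply/rV_norm_leP => [|i]; first exact: ltW.
rewrite !mxE; move: i; near: k; apply: filter_forall => i.
by have /cvgrPdist_le /(_ _ e0) := vx i.
Unshelve. all: by end_near. Qed.

Lemma cvg_norm_le (V : normedModType R) (v : nat -> V) l r : v @ \oo --> l ->
  (forall k, `|v k| <= r) -> `|l| <= r.
Proof.
move=> /cvg_norm vx vr; rewrite -(cvg_lim _ vx)//.
by apply: limr_le; [apply/cvg_ex; eexists; exact: vx|exact: nearW].
Qed.

End rV_norm.

Section homogeneous_eval.
Context {R : realType} {n : nat}.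
Implicit Types (p : mpoly n R) (h : 'rV[R]_n).

Lemma poly_eval_le r p h : `|h| <= r -> `|poly_eval p h| <= mnorm r p.
Proof.
move=> hr; have r0 : 0 <= r by rewrite (le_trans _ hr).
by apply: meval_le => // i; move: i; exact/rV_norm_leP.
Qed.

Lemma homogeneous0_eval p h : homogeneous 0 p -> poly_eval p h = poly_eval p 0.
Proof.
move=> p0; rewrite !poly_evalE; apply: eq_big_seq => m /p0 /eqP.
by rewrite mdeg_eq0 => /eqP ->; rewrite !mpolyX0 !meval1.
Qed.

Lemma homogeneousS_eval0 k p : homogeneous k.+1 p -> poly_eval p 0 = 0.
Proof.
move=> pk; apply/eqP; rewrite -normr_le0.
rewrite (le_trans (@poly_eval_le 0 _ _ _)) ?normr0//.
by rewrite (mnorm_homogeneous _ pk) exprS mul0r mulr0.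
Qed.

Lemma homogeneous1_eval p h : homogeneous 1 p ->
  poly_eval p h = \sum_i h ord0 i * poly_eval p (delta_mx ord0 i).
Proof.
move=> p1; under [RHS]eq_bigr do rewrite poly_evalE mulr_sumr.
rewrite exchange_big/= poly_evalE; apply: eq_big_seq => m /p1 /eqP/mdeg1P[j /eqP ->].
rewrite (bigD1 j)//= big1 ?addr0 => [|i ij]; rewrite !mevalXU mxE eqxx.
  by rewrite eqxx mulr1 mulrC.
by rewrite (eq_sym j) (negbTE ij) !mulr0.
Qed.

(** Evaluation is the substitution of constants, seen as polynomials in zero variables, so the bound
    is an instance of [mnorm_mcomp_lip] at radius 0. *)
Lemma poly_eval_lip k p h h' s t : homogeneous k p -> 0 <= s -> 
  `|h| <= s -> `|h'| <= s -> `|h - h'| <= t ->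
  `|poly_eval p h - poly_eval p h'| <= mnorm 1 p * (k%:R * s ^+ k.-1 * t).
Proof.
move=> pk s0 hs h's hht; have t0 : 0 <= t by rewrite (le_trans _ hht).
pose C (h : 'rV[R]_n) i : mpoly 0 R := mpolyC 0 (h ord0 i).
have E x : mcomp (C x) p = mpolyC 0 (poly_eval p x).
  rewrite mcompE /poly_eval mevalE rmorph_sum/=; apply: eq_bigr => m _.
  rewrite rmorphM/= mul_mpolyC; congr (_ *: _); rewrite rmorph_prod/=.
  by apply: eq_bigr => i _; rewrite rmorphXn.
have := @mnorm_mcomp_lip R n k 0 (C h) (C h') p 0 s t pk (lexx 0) s0 t0.
rewrite !E -rmorphB/= mnormC; apply => i; rewrite ?mnormC.
- exact: (le_trans (rV_coord_le _ _)).
- exact: (le_trans (rV_coord_le _ _)).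
rewrite -rmorphB/= mnormC; have := rV_coord_le (h - h') i; rewrite !mxE.
by move/le_trans; apply.
Qed.

End homogeneous_eval.

Section expansion_theory.
Context {R : realType} {n : nat}.
Implicit Types (u : 'rV[R]_n -> R) (h : 'rV[R]_n).

(** For k >= 1 this is k <= 2^(k-1): halving the radius pays for the factor k that differentiation
    brings. *)
Lemma natmul_half_le (r : R) k : 0 < r -> k%:R * (r / 2) ^+ k.-1 <= r^-1 * r ^+ k.
Proof.
move=> r0; case: k => [|k]; first by rewrite mul0r expr0 mulr1 invr_ge0 ltW.
rewrite /= exprS mulKf ?gt_eqF// exprMn exprVn mulrCA ler_piMr ?exprn_ge0 ?(ltW r0)//.
by rewrite ler_pdivrMr ?exprn_gt0// mul1r -natrX ler_nat ltn_expl.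
Qed.

(** In degree at least 2 a factor [s] survives, so the Lipschitz constant of a map vanishing to
    second order can be made small by shrinking [s]. *)
Lemma natmul_pow_le (r s : R) k : 0 < r -> 0 <= s <= r / 2 ->
  k.+2%:R * s ^+ k.+1 <= 2 * s / r ^+ 2 * r ^+ k.+2.
Proof.
move=> r0 /andP[s0 sr].
have -> : 2 * s / r ^+ 2 * r ^+ k.+2 = 2 * s * r ^+ k.
  by rewrite -[k.+2]add2n exprD; field; rewrite gt_eqF.
rewrite exprS mulrCA -mulrA [leRHS]mulrCA ler_wpM2l//.
rewrite (@le_trans _ _ (k.+2%:R * (r / 2) ^+ k))//.
  by rewrite ler_wpM2l// lerXn2r// nnegrE divr_ge0// ltW.
rewrite exprMn exprVn mulrCA mulrC ler_wpM2r ?exprn_ge0 ?(ltW r0)//.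
rewrite ler_pdivrMr ?exprn_gt0// -natrX -natrM ler_nat.
by rewrite -expnS; elim: k => // k IHk; rewrite expnS mul2n -addnn -addn1 leq_add// expn_gt0.
Qed.

Lemma expansion_ge0 u H r B : expansion u H r B -> 0 <= B.
Proof. by case=> _ _ /(_ 0%N) + _; rewrite big_nil. Qed.

Lemma expansion_shrink u H r B r' B' : 0 < r' -> r' <= r -> B <= B' ->
  expansion u H r B -> expansion u H r' B'.
Proof.
move=> r'0 rr' BB' [r0 Hk HB Hu]; split=> // [K|h hr]; last first.
  by apply: Hu => i; rewrite (le_trans (hr i)).
rewrite (le_trans _ BB')// (le_trans _ (HB K))//; apply: ler_sum => k _.
by rewrite ler_wpM2l ?mnorm_ge0// lerXn2r// nnegrE ltW.
Qed.

Lemma expansion_family (I : finType) (u : I -> 'rV[R]_n -> R) :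
  (forall j, exists H r B, expansion (u j) H r B) ->
  exists H r B, [/\ 0 < r, 0 <= B & forall j, expansion (u j) (H j) r B].
Proof.
move=> uE.
have /choice[F FE] : forall j, exists F : (nat -> mpoly n R) * R * R,
    expansion (u j) F.1.1 F.1.2 F.2.
  by move=> j; have [H [r [B HE]]] := uE j; exists (H, r, B).
have F0 j : 0 < (F j).1.2 by case: (FE j).
have B0 j : 0 <= (F j).2 by exact: expansion_ge0 (FE j).
have s0 : 0 < 1 + \sum_j (F j).1.2^-1.
  by rewrite ltr_wpDr// sumr_ge0// => j _; rewrite invr_ge0 ltW.
(* The reciprocal of 1 plus the sum of the reciprocals lies below every radius and is positive even
   for an empty family. *)
exists (fun j => (F j).1.1), (1 + \sum_j (F j).1.2^-1)^-1, (\sum_j (F j).2).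
split=> [||j]; [by rewrite invr_gt0|exact: sumr_ge0|].
apply: expansion_shrink (FE j); first by rewrite invr_gt0.
- rewrite invf_ple ?posrE// (bigD1 j)//= addrCA lerDl addr_ge0//.
  by rewrite sumr_ge0// => i _; rewrite invr_ge0 ltW.
- by rewrite (bigD1 j)//= lerDl sumr_ge0.
Qed.

Lemma expansion0 u H r B : expansion u H r B -> poly_eval (H 0%N) 0 = u 0.
Proof.
move=> [r0 Hk HB Hu]; have z i : `|(0 : 'rV[R]_n) ord0 i| <= r by rewrite mxE normr0 ltW.
have Hu0 := Hu 0 z.
apply: (@cvg_unique _ _ (series (fun k => poly_eval (H k) 0) @ \oo)) => //.
  apply: cvg_near_cst; exists 1%N => // -[//|K] _ /=.
  rewrite /series/= big_nat_recl// big1 ?addr0// => k _.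
  by rewrite (@homogeneousS_eval0 _ _ k).
Qed.

Lemma series_lip (H : nat -> mpoly n R) K l (P Q : 'I_n -> mpoly l R) r s t :
  (forall k, homogeneous k (H k)) -> 0 <= r -> 0 <= s -> 0 <= t ->
  (forall i, mnorm r (P i) <= s) -> (forall i, mnorm r (Q i) <= s) ->
  (forall i, mnorm r (P i - Q i) <= t) ->
  mnorm r (\sum_(0 <= k < K) mcomp P (H k) - \sum_(0 <= k < K) mcomp Q (H k)) <=
  (\sum_(0 <= k < K) mnorm 1 (H k) * (k%:R * s ^+ k.-1)) * t.
Proof.
move=> Hk r0 s0 t0 Ps Qs PQt; rewrite -sumrB (le_trans (mnorm_sum _ _ _ _))//.
rewrite mulr_suml; apply: ler_sum => k _.
by rewrite -mulrA mnorm_mcomp_lip.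
Qed.

Lemma expansion_lip_bound u H r B K : expansion u H r B ->
  \sum_(0 <= k < K) mnorm 1 (H k) * (k%:R * (r / 2) ^+ k.-1) <= r^-1 * B.
Proof.
move=> [r0 Hk HB _]; apply: le_trans (ler_wpM2l _ (HB K)); last by rewrite invr_ge0 ltW.
rewrite mulr_sumr; apply: ler_sum => k _.
by rewrite [leRHS]mulrCA ler_wpM2l ?mnorm_ge0// natmul_half_le.
Qed.

(** Truncation order and evaluation point move together, as they do in a composition or an
    iteration. On the half radius all truncations share the Lipschitz constant of
    [expansion_lip_bound], so replacing [w] by [v K] costs a fixed multiple of their distance. *)
Lemma expansion_cvg u H r B (v : nat -> 'rV[R]_n) w : expansion u H r B ->
  (forall K, `|v K| <= r / 2) -> `|w| <= r / 2 -> v @ \oo --> w ->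
  (fun K => \sum_(0 <= k < K) poly_eval (H k) (v K)) @ \oo --> u w.
Proof.
move=> uE vr wr vw; have [r0 Hk HB Hu] := uE.
have r2 : r / 2 <= r by rewrite ler_pdivrMr// ler_pMr// ler1n.
have r20 : 0 <= r / 2 by rewrite divr_ge0// ltW.
pose C := r^-1 * B + 1.
have C0 : 0 < C.
  by rewrite ltr_wpDl// mulr_ge0 ?(expansion_ge0 uE)// invr_ge0 ltW.
apply/cvgrPdist_le => e e0.
have e2 : 0 < e / 2 by rewrite divr_gt0.
have eC : 0 < e / 2 / C by rewrite divr_gt0.
have wi i : `|w ord0 i| <= r by rewrite (le_trans (rV_coord_le _ _))// (le_trans wr).
have /cvgrPdist_le /(_ _ e2) uw := Hu w wi.
have /cvgrPdist_le /(_ _ eC) {}vw := vw.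
near=> K.
rewrite (splitr e) -(subrKA (series (fun k => poly_eval (H k) w) K)).
rewrite (le_trans (ler_normD _ _))// lerD//; first by near: K.
have vwK : `|w - v K| <= e / 2 / C by near: K.
rewrite /series/= -sumrB (le_trans (ler_norm_sum _ _ _))//.
rewrite (@le_trans _ _ ((\sum_(0 <= k < K) mnorm 1 (H k) * (k%:R * (r / 2) ^+ k.-1)) * (e / 2 / C)))//.
  rewrite mulr_suml; apply: ler_sum => k _.
  by rewrite -mulrA; apply: poly_eval_lip => //.
rewrite (le_trans (ler_wpM2r (ltW eC) (expansion_lip_bound K uE)))//.
rewrite mulrA ler_pdivrMr// mulrC ler_wpM2l ?(ltW e2)//.
by rewrite /C lerDl.
Unshelve. all: by end_near. Qed.

End expansion_theory.

(** * Differentials, composition and inversion of analytic maps *)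

(** Vectors are rows, so [J] acts on the right: it is the transpose of the usual Jacobian matrix,
    its i-th row is the derivative along the i-th axis, and composition multiplies matrices in the
    order of application. *)
Definition fderiv {R : realType} {n m : nat} (f : 'rV[R]_n -> 'rV[R]_m)
    (x : 'rV[R]_n) (J : 'M[R]_(n, m)) :=
  forall e, 0 < e -> exists2 d, 0 < d & forall h, `|h| <= d ->
    `|f (x + h) - f x - h *m J| <= e * `|h|.

Lemma mulmx_norm_le {R : realType} {n m : nat} (J : 'M[R]_(n, m)) :
  exists2 C, 0 < C & forall h : 'rV[R]_n, `|h *m J| <= C * `|h|.
Proof.
exists (1 + \sum_i \sum_j `|J i j|).
  by rewrite ltr_pwDl// sumr_ge0// => i _; rewrite sumr_ge0.
move=> h; apply/rV_norm_leP => [|j].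
  rewrite mulr_ge0// addr_ge0// sumr_ge0// => i _; by rewrite sumr_ge0.
rewrite mxE (le_trans (ler_norm_sum _ _ _))// mulrDl mul1r mulr_suml.
rewrite ler_wpDl//; apply: ler_sum => i _; rewrite normrM mulrC ler_pM ?rV_coord_le//.
by rewrite (bigD1 j)//= lerDl sumr_ge0.
Qed.

Section analytic_fderiv.
Context {R : realType} {n : nat}.

(** For k >= 2 the power |h|^k is at most (|h| / r)^2 r^k, so the quadratic factor comes out of the
    whole tail. *)
Lemma expansion_order2 (u : 'rV[R]_n -> R) H r B h : expansion u H r B -> `|h| <= r ->
  `|u h - u 0 - poly_eval (H 1%N) h| <= (`|h| / r) ^+ 2 * B.
Proof.
move=> uE hr; have [r0 Hk HB Hu] := uE.
have hri i : `|h ord0 i| <= r by rewrite (le_trans (rV_coord_le _ _)).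
have cv : (fun K => `|series (fun k => poly_eval (H k) h) K - u 0 - poly_eval (H 1%N) h|) @ \oo -->
    `|u h - u 0 - poly_eval (H 1%N) h|.
  apply: cvg_norm; apply: cvgB; last exact: cvg_cst.
  by apply: cvgB; [exact: Hu|exact: cvg_cst].
rewrite -(cvg_lim _ cv)//; apply: limr_le; first by apply/cvg_ex; eexists; exact: cv.
exists 2%N => // K /= K2.
rewrite /series/= (big_cat_nat (n := 2))//= 2?big_nat_recr//= big_nil add0r.
rewrite (homogeneous0_eval _ (Hk 0%N)) (expansion0 uE).
rewrite (_ : _ - _ = \sum_(2 <= k < K) poly_eval (H k) h); last by ring.
rewrite (le_trans (ler_norm_sum _ _ _))// (le_trans _ (ler_wpM2l _ (HB K)))//; last first.
  by rewrite exprn_ge0// divr_ge0// ltW.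
rewrite mulr_sumr [leRHS](big_cat_nat (n := 2) (p := K))//= -[leLHS]add0r lerD//.
  rewrite sumr_ge0// => k _.
  apply: mulr_ge0; first by rewrite exprn_ge0// divr_ge0// ltW.
  by rewrite mulr_ge0 ?mnorm_ge0// exprn_ge0// ltW.
rewrite big_nat_cond [leRHS]big_nat_cond; apply: ler_sum => k; rewrite andbT => /andP[k2 _].
rewrite (le_trans (poly_eval_le _ (lexx _)))// (mnorm_homogeneous _ (Hk k)).
rewrite mulrCA ler_wpM2l ?mnorm_ge0//.
rewrite -(subnK k2) !exprD.
rewrite [leRHS](_ : _ = r ^+ (k - 2) * `|h| ^+ 2); last by field; rewrite gt_eqF.
by rewrite ler_wpM2r ?exprn_ge0// lerXn2r// nnegrE// ltW.
Qed.

Lemma expansion_fderiv m (f : 'rV[R]_n -> 'rV[R]_m) x H r B :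
  (forall j, expansion (fun h => f (x + h) ord0 j) (H j) r B) -> 0 < r ->
  fderiv f x (\matrix_(i, j) poly_eval (H j 1%N) (delta_mx ord0 i)).
Proof.
(* When [m] is 0 there is no expansion to make [B] nonnegative; [B'] is positive in all cases. *)
move=> fE r0 e e0; pose B' := `|B| + 1.
have B'0 : 0 < B' by rewrite ltr_wpDl.
exists (Num.min r (e * r ^+ 2 / B')).
  by rewrite lt_min r0 divr_gt0// mulr_gt0// exprn_gt0.
move=> h; rewrite le_min => /andP[hr he].
apply/rV_norm_leP => [|j]; first by rewrite mulr_ge0// ltW.
have := expansion_order2 (fE j) hr; rewrite addr0.
rewrite homogeneous1_eval; last by case: (fE j).
rewrite !mxE; under [X in _ -> `|_ - X| <= _]eq_bigr do rewrite mxE.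
move/le_trans; apply.
have BB' : B <= B' by rewrite /B' (le_trans (ler_norm _))// lerDl.
rewrite (le_trans (ler_wpM2l (exprn_ge0 _ (divr_ge0 _ (ltW r0))) BB'))//.
rewrite (_ : _ * B' = `|h| * B' / r ^+ 2 * `|h|); last by field; rewrite gt_eqF.
by rewrite ler_wpM2r// ler_pdivrMr ?exprn_gt0// -ler_pdivlMr.
Qed.

Lemma analytic_fderiv m (f : 'rV[R]_n -> 'rV[R]_m) x : real_analytic_at f x ->
  exists J, fderiv f x J.
Proof.
move=> fx; have /expansion_family[H [r [B [r0 _ HE]]]] :
    forall j, exists H r B, expansion (fun h => f (x + h) ord0 j) H r B.
  by move=> j; exact: (@analytic_expansion _ _ (fun y => f y ord0 j) x (fx j)).
by eexists; exact: (@expansion_fderiv m f x H r B HE r0).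
Qed.

Lemma fderiv_continuous m (f : 'rV[R]_n -> 'rV[R]_m) x J : fderiv f x J ->
  {for x, continuous f}.
Proof.
move=> /(_ _ ltr01)[d d0 fd]; have [C C0 JC] := mulmx_norm_le J.
apply/continuous_rVP => e e0.
have C1 : 0 < 1 + C by rewrite addr_gt0.
exists (Num.min d (e / (1 + C))); first by rewrite lt_min d0 divr_gt0.
move=> h; rewrite le_min => /andP[hd he].
rewrite distrC -(subrK (h *m J) (_ - _)) (le_trans (ler_normD _ _))//.
rewrite (le_trans (lerD (fd _ hd) (JC h)))// -mulrDl mulrC.
by rewrite -ler_pdivlMr.
Qed.

End analytic_fderiv.

Section fderiv_theory.
Context {R : realType}.

Lemma analytic_continuous n m (f : 'rV[R]_n -> 'rV[R]_m) x :
  real_analytic_at f x -> {for x, continuous f}.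
Proof. by move=> /analytic_fderiv[J /fderiv_continuous]. Qed.

Lemma analytic_near_eq n m (f g : 'rV[R]_n -> 'rV[R]_m) x :
  (\forall y \near x, f y = g y) -> real_analytic_at f x -> real_analytic_at g x.
Proof.
move=> /near_addP[d d0 fg] fx j; have [c [r [r0 cr]]] := fx j.
exists c, (Num.min r d); split=> [|h hr]; first by rewrite lt_min r0.
have hd : `|h| <= d.
  apply/rV_norm_leP => [|i]; first exact: ltW.
  by have := hr i; rewrite lt_min => /andP[_ /ltW].
have [] := cr h; last by rewrite fg.
by move=> i; have := hr i; rewrite lt_min => /andP[].
Qed.

Lemma analytic_mpoly n m (p : 'I_m -> mpoly n R) a :
  real_analytic_at (fun x => \row_j poly_eval (p j) x) a.
Proof.
move=> j.
(* The polynomial re-expanded at [a]; the constant sequence [q] has variation 0. *)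
pose q := mcomp (fun i => mpolyC n (a ord0 i) + mpolyX R (mnm1 i)) (p j).
apply: (@analytic_of_bounded_variation R n (fun x => (\row_j poly_eval (p j) x) ord0 j) a
  (fun=> q) 1 0) => // [K|h _].
  by rewrite big1// => k _; rewrite subrr mnorm0.
rewrite mxE (_ : poly_eval q h = poly_eval (p j) (a + h)); last first.
  rewrite /poly_eval meval_mcomp; congr (meval _ _); apply/funext => i.
  by rewrite mevalD mevalC mevalXU !mxE.
exact: cvg_cst.
Qed.

(** The approximants substitute truncations of [u - u a] into truncations of [phi]. An increment
    splits into the new degree of [phi], summable at radius [r], and the effect of the new degree of
    [u], controlled by the Lipschitz bound on the half radius [s]. *)
Lemma analytic_comp n m (phi : 'rV[R]_m -> R) (u : 'rV[R]_n -> 'rV[R]_m) a :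
  analytic_fun_at phi (u a) -> real_analytic_at u a ->
  analytic_fun_at (phi \o u) a.
Proof.
move=> /analytic_expansion[H [r [B pE]]] ua.
have /expansion_family[G [q [D [q0 D0 uE]]]] :
    forall j, exists H r B, expansion (fun h => u (a + h) ord0 j) H r B.
  by move=> j; exact: (@analytic_expansion _ _ (fun y => u y ord0 j) a (ua j)).
have [r0 Hk HB _] := pE; have B0 := expansion_ge0 pE.
pose s := r / 2; have s0 : 0 < s by rewrite divr_gt0.
have sD : 0 < s + D by rewrite ltr_wpDr.
(* Without constant terms, norms shrink at least by the factor t / q when the radius goes from [q]
   to [t], and t D / q = s D / (s + D) <= s: the truncations of [u - u a] stay within norm [s]. *)
pose t := q * (s / (s + D)).
have t0 : 0 < t by rewrite mulr_gt0// divr_gt0.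
have tq : t <= q by rewrite /t ler_piMr ?(ltW q0)// ler_pdivrMr// mul1r lerDl.
pose P K j := \sum_(0 <= k < K) G j k.+1.
have Gt j K : \sum_(0 <= k < K) mnorm t (G j k.+1) <= s.
  have [_ Gk GD _] := uE j.
  rewrite (@le_trans _ _ (t / q * D))//; last first.
    rewrite /t [q * _]mulrC mulfK ?gt_eqF// mulrAC ler_pdivrMr// ler_wpM2l ?(ltW s0)//.
    by rewrite lerDr ltW.
  apply: le_trans (ler_wpM2l _ (GD K.+1)); last by rewrite divr_ge0// ltW.
  rewrite big_nat_recl// mulrDr ler_wpDl//.
    by rewrite mulr_ge0 ?divr_ge0 ?(ltW t0) ?(ltW q0)// mulr_ge0 ?mnorm_ge0// ltW.
  rewrite mulr_sumr; apply: ler_sum => k _; rewrite (mnorm_homogeneous _ (Gk _)).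
  rewrite mulrCA ler_wpM2l ?mnorm_ge0//.
  rewrite !exprS mulrA mulfVK ?gt_eqF// ler_wpM2l ?(ltW t0)//.
  by rewrite lerXn2r// nnegrE ltW.
have Ps K j : mnorm t (P K j) <= s.
  by rewrite (le_trans (mnorm_sum _ _ _ (ltW t0))).
pose Q K := \sum_(0 <= k < K) mcomp (P K) (H k).
apply: (@analytic_of_bounded_variation R n (phi \o u) a Q t
  (B + r^-1 * B * \sum_(j < m) s)) => // [K|h ht].
  rewrite (@le_trans _ _ (\sum_(0 <= k < K) (mnorm 1 (H k) * r ^+ k +
      r^-1 * B * \sum_j mnorm t (G j k.+1))))//; last first.
    rewrite big_split/= lerD// -mulr_sumr ler_wpM2l//.
      by rewrite mulr_ge0// invr_ge0 ltW.
    by rewrite exchange_big/=; apply: ler_sum => j _.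
  apply: ler_sum => k _.
  have -> : Q k.+1 - Q k = mcomp (P k.+1) (H k) +
      (\sum_(0 <= i < k) mcomp (P k.+1) (H i) - \sum_(0 <= i < k) mcomp (P k) (H i)).
    by rewrite {1}/Q big_nat_recr//= addrAC addrC.
  rewrite (le_trans (mnormD _ _ (ltW t0)))// lerD//.
    rewrite (le_trans (mnorm_mcomp _ (ltW t0) (Ps k.+1)))//.
    rewrite (mnorm_homogeneous _ (Hk k)) ler_wpM2l ?mnorm_ge0//.
    by rewrite lerXn2r ?nnegrE ?ltW// /s ltr_pdivrMr// ltr_pMr// ltr1n.
  rewrite (le_trans (series_lip (t := \sum_j mnorm t (G j k.+1)) k Hk (ltW t0) (ltW s0) _ (Ps k.+1) (Ps k) _))//.
  - by rewrite sumr_ge0// => j _; rewrite mnorm_ge0// ltW.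
  - move=> j; rewrite /P big_nat_recr//= addrAC subrr add0r.
    by rewrite (bigD1 j)//= lerDl sumr_ge0// => i _; rewrite mnorm_ge0// ltW.
  rewrite ler_wpM2r ?(expansion_lip_bound _ pE)//.
  by rewrite sumr_ge0// => j _; rewrite mnorm_ge0// ltW.
pose v K : 'rV[R]_m := \row_j poly_eval (P K j) h.
have ht' : `|h| <= t by apply/rV_norm_leP => //; exact: ltW.
have vs K : `|v K| <= s.
  apply/rV_norm_leP => [|j]; first exact: ltW.
  by rewrite mxE (le_trans (poly_eval_le _ ht')).
have vw : v @ \oo --> u (a + h) - u a.
  apply: cvg_rowP => j; rewrite !mxE.
  have [_ Gk _ Gu] := uE j.
  have := Gu h (fun i => le_trans (ht i) tq).
  rewrite -(cvg_shiftS (series _)) => Gcv.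
  have := expansion0 (uE j); rewrite addr0 => <-.
  have -> : (fun K => v K ord0 j) =
    (fun K => series (fun k => poly_eval (G j k) h) K.+1 - poly_eval (G j 0%N) 0).
    apply/funext => K; rewrite mxE /P /series/= big_nat_recl//.
    rewrite (homogeneous0_eval _ (Gk 0%N)) addrAC subrr add0r.
    by rewrite /poly_eval raddf_sum.
  by apply: cvgB => //; exact: cvg_cst.
have := expansion_cvg pE vs (cvg_norm_le vw vs) vw.
rewrite addrCA subrr addr0.
suff -> : (fun k => poly_eval (Q k) h) =
    (fun K => \sum_(0 <= k < K) poly_eval (H k) (v K)) by [].
apply/funext => K; rewrite /Q /poly_eval raddf_sum/=; apply: eq_bigr => k _.
by rewrite meval_mcomp; congr (meval _ _); apply/funext => j; rewrite mxE.
Qed.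

End fderiv_theory.

(** The sum S of the first [K.+1] terms satisfies S <= D 0 + E + S / 2, which is solved for S. *)
Lemma contraction_sum_bound (R : realType) (D e : nat -> R) E K :
  (forall k, 0 <= D k) -> (forall k, D k.+1 <= e k + D k / 2) ->
  (forall K, \sum_(0 <= k < K) e k <= E) ->
  \sum_(0 <= k < K) D k <= 2 * (D 0%N + E).
Proof.
move=> D0 De eE; case: K => [|K].
  rewrite big_nil mulr_ge0// addr_ge0//; have := eE 0%N; by rewrite big_nil.
have : \sum_(0 <= k < K.+1) D k <= D 0%N + (E + (\sum_(0 <= k < K.+1) D k) / 2).
  rewrite {1}big_nat_recl// lerD2l.
  apply: le_trans (ler_sum _ (fun k _ => De k)) _; rewrite big_split/= lerD//.
  by rewrite -mulr_suml ler_wpM2r// big_nat_recr//= lerDl.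
lra.
Qed.

Lemma bounded_variation_cvg (R : realType) (x : nat -> R) B :
  (forall K, \sum_(0 <= k < K) `|x k.+1 - x k| <= B) -> cvgn x.
Proof.
move=> xB; have : cvgn (series (fun k => x k.+1 - x k)).
  apply: normed_cvg; apply: nondecreasing_is_cvgn.
    by apply: nondecreasing_series => k _ _ /=.
  by exists B => _ [K _ <-]; exact: xB.
move=> /cvg_ex[l xl]; apply/cvg_ex; exists (x 0%N + l).
have E : x = fun K => x 0%N + series (fun k => x k.+1 - x k) K.
  by apply/funext => K; rewrite /series/= telescope_sumr// addrC subrK.
by rewrite [X in X @ _]E; apply: cvgD; [exact: cvg_cst|exact: xl].
Qed.

Section analytic_inverse.
Context {R : realType} {n : nat}.

Lemma expansion_sum (I : finType) (a : I -> R) (u : I -> 'rV[R]_n -> R)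
    (H : I -> nat -> mpoly n R) r B : 0 < r -> 0 <= B ->
  (forall i, expansion (u i) (H i) r B) ->
  expansion (fun h => \sum_i a i * u i h) (fun k => \sum_i a i *: H i k) r
    ((\sum_i `|a i|) * B).
Proof.
move=> r0 B0 uE; split=> // [k|K|h hr].
- by apply: homogeneous_sum => i _; apply: homogeneousZ; case: (uE i).
- rewrite (@le_trans _ _ (\sum_(0 <= k < K) \sum_i `|a i| * (mnorm 1 (H i k) * r ^+ k)))//.
    apply: ler_sum => k _; under [leRHS]eq_bigr do rewrite mulrA.
    rewrite -mulr_suml ler_wpM2r ?exprn_ge0 ?(ltW r0)//.
    rewrite (le_trans (mnorm_sum _ _ _ ler01))//; apply: ler_sum => i _.
    exact: mnormZ_le.
  rewrite exchange_big/= mulr_suml; apply: ler_sum => i _.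
  by rewrite -mulr_sumr ler_wpM2l//; case: (uE i).
rewrite (_ : series _ = fun K => \sum_i a i * series (fun k => poly_eval (H i k) h) K).
  apply: (cvg_big (@add_continuous R)) => i _.
  by apply: cvgMr; case: (uE i) => _ _ _; exact.
apply/funext => K; rewrite /series/=; under [RHS]eq_bigr do rewrite mulr_sumr.
rewrite exchange_big/=; apply: eq_bigr => k _.
rewrite /poly_eval raddf_sum/=; apply: eq_bigr => i _; exact: mevalZ.
Qed.

Lemma expansion_tail2 (u : 'rV[R]_n -> R) H r B : expansion u H r B ->
  expansion (fun h => u h - u 0 - poly_eval (H 1%N) h)
    (fun k => if (k < 2)%N then 0 else H k) r B.
Proof.
move=> uE; have [r0 Hk HB Hu] := uE; split=> // [k|K|h hr].
- by case: ifP => // _ m; rewrite msupp0.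
- rewrite (le_trans _ (HB K))//; apply: ler_sum => k _; case: ifP => // _.
  by rewrite mnorm0 mul0r mulr_ge0 ?mnorm_ge0 ?exprn_ge0// ltW.
have -> : u 0 = poly_eval (H 0%N) h.
  by rewrite (homogeneous0_eval _ (Hk 0%N)) (expansion0 uE).
have cv : (fun K => series (fun k => poly_eval (H k) h) K - poly_eval (H 0%N) h - poly_eval (H 1%N) h) @ \oo -->
    u h - poly_eval (H 0%N) h - poly_eval (H 1%N) h.
  apply: cvgB; last exact: cvg_cst.
  by apply: cvgB; [exact: Hu|exact: cvg_cst].
apply: cvg_trans cv; apply: near_eq_cvg; exists 2%N => // K /= K2.
rewrite /series/= !(@big_cat_nat _ _ _ 2 0 K)//= !big_nat_recr//= !big_nil.
rewrite (_ : poly_eval 0 h = 0); last by rewrite /poly_eval meval0.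
rewrite !add0r (_ : poly_eval _ _ + _ + _ - _ - _ = \sum_(2 <= k < K) poly_eval (H k) h); last by ring.
apply: eq_big_nat => k /andP[k2 _].
by rewrite ltnNge k2.
Qed.

(** The iteration yields [w] with [f (x + w) = f x + h], so small that [g] inverts [f] at [x + w];
    hence [g (f x + h) = x + w]. The iterates are polynomials in [h] of bounded variation, so [w]
    depends analytically on [h]. *)
Lemma analytic_inverse (f g : 'rV[R]_n -> 'rV[R]_n) x : real_analytic_at f x ->
  (forall J, fderiv f x J -> J \in unitmx) ->
  (\forall y \near x, g (f y) = y) -> real_analytic_at g (f x).
Proof.
move=> fx fJ /near_addP[d d0 gf].
have /expansion_family[H [r0 [B0 [r00 B00 HE0]]]] :
    forall j, exists H r B, expansion (fun h => f (x + h) ord0 j) H r B.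
  by move=> j; exact: (@analytic_expansion _ _ (fun y => f y ord0 j) x (fx j)).
pose r := Num.min r0 d.
have r_gt0 : 0 < r by rewrite lt_min r00.
have rd : r <= d by rewrite ge_min lexx orbT.
have HE j : expansion (fun h => f (x + h) ord0 j) (H j) r B0.
  by apply: expansion_shrink (HE0 j) => //; rewrite ge_min lexx.
pose J : 'M[R]_n := \matrix_(i, j) poly_eval (H j 1%N) (delta_mx ord0 i).
have Ju : J \in unitmx by apply: fJ; exact: (@expansion_fderiv _ _ _ f x H r B0 HE r_gt0).
have H1 j h : poly_eval (H j 1%N) h = (h *m J) ord0 j.
  rewrite homogeneous1_eval; last by case: (HE j).
  by rewrite mxE; apply: eq_bigr => i _; rewrite mxE.
(* [f (x + v) = f x + h] is the fixed point equation [v = h *m A + Phi v], where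
   [Phi] vanishes to order two and is hence a contraction for small [v]. *)
pose A := invmx J.
pose psi j k := \sum_i (- A i j) *: (if (k < 2)%N then 0 else H i k).
pose Phi h j := \sum_i - A i j *
  (f (x + h) ord0 i - f x ord0 i - poly_eval (H i 1%N) h).
pose B := \sum_j (\sum_i `|- A i j|) * B0.
have PhiE j : expansion (fun h => Phi h j) (psi j) r B.
  have HE2 i : expansion (fun h => f (x + h) ord0 i - f x ord0 i - poly_eval (H i 1%N) h)
      (fun k => if (k < 2)%N then 0 else H i k) r B0.
    by have := expansion_tail2 (HE i); rewrite addr0.
  apply: expansion_shrink (expansion_sum (fun i => - A i j) r_gt0 B00 HE2) => //.
  by rewrite /B [leRHS](bigD1 j)//= lerDl sumr_ge0// => i _; rewrite mulr_ge0// sumr_ge0.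
have B_ge0 : 0 <= B.
  by rewrite sumr_ge0// => i _; rewrite mulr_ge0// sumr_ge0.
have PhiP h : \row_j Phi h j = h - (f (x + h) - f x) *m A.
  apply/rowP => j; rewrite !mxE /Phi.
  under eq_bigr do rewrite H1 mulNr mulrBr opprB.
  rewrite sumrB; congr (_ - _); last first.
    by apply: eq_bigr => i _; rewrite !mxE mulrC.
  have := congr1 (fun M : 'rV[R]_n => M ord0 j) (mulmxK Ju h); rewrite mxE => <-.
  by apply: eq_bigr => i _; rewrite mulrC.
(* The first summand gives each component of [Phi] a Lipschitz constant at most 1 / (2 (n + 1)) at
   radius [s], so that the sum over the [n] components contracts by 1/2; the second gives
   [s <= r / 2]. *)
pose N := 4 * n.+1%:R * B + 2 * r.
have N0 : 0 < N.
  by rewrite ltr_wpDl ?mulr_gt0// !mulr_ge0.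
pose s := r ^+ 2 / N.
have s0 : 0 < s by rewrite divr_gt0// exprn_gt0.
have sr : s <= r / 2.
  rewrite /s ler_pdivrMr//.
  have -> : r / 2 * N = r ^+ 2 + 2 * n.+1%:R * B * r by rewrite /N; field.
  by rewrite lerDl !mulr_ge0// ltW.
have sB : 4 * n.+1%:R * B * s <= r ^+ 2.
  rewrite /s mulrA ler_pdivrMr// mulrC ler_wpM2l ?exprn_ge0 ?(ltW r_gt0)//.
  by rewrite lerDl mulr_ge0// ltW.
have psik j k : homogeneous k (psi j k) by case: (PhiE j).
have psi0 j : psi j 0%N = 0 by rewrite /psi big1// => i _; rewrite scaler0.
have psi1 j : psi j 1%N = 0 by rewrite /psi big1// => i _; rewrite scaler0.
have psi_lip j K : \sum_(0 <= k < K) mnorm 1 (psi j k) * (k%:R * s ^+ k.-1) <=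
    (2 * n.+1%:R)^-1.
  have [_ _ psiB _] := PhiE j.
  have c0 : 0 <= 2 * s / r ^+ 2.
    by rewrite divr_ge0 ?exprn_ge0 ?(ltW r_gt0)// mulr_ge0// ltW.
  rewrite (@le_trans _ _ (2 * s / r ^+ 2 * B))//.
    rewrite (le_trans _ (ler_wpM2l c0 (psiB K)))// mulr_sumr.
    apply: ler_sum => k _; rewrite [leRHS]mulrCA.
    case: k => [|[|k]]; first by rewrite psi0 mnorm0 !mul0r.
      by rewrite psi1 mnorm0 !mul0r.
    by rewrite ler_wpM2l ?mnorm_ge0// natmul_pow_le// (ltW s0).
  rewrite mulrAC ler_pdivrMr ?exprn_gt0// [leRHS]mulrC ler_pdivlMr ?mulr_gt0//.
  by rewrite (le_trans _ sB)// [leLHS](_ : _ = 4 * n.+1%:R * B * s)//; ring.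
(* Degree 0 vanishes and s^k <= s (k s^(k-1)) for k >= 1, so the Lipschitz bound also bounds the
   norm. *)
have psi_small j K : \sum_(0 <= k < K) mnorm s (psi j k) <= s / 2.
  rewrite (@le_trans _ _ (s * (2 * n.+1%:R)^-1))//.
    rewrite (le_trans _ (ler_wpM2l (ltW s0) (psi_lip j K)))// mulr_sumr.
    apply: ler_sum => k _; case: k => [|k].
      by rewrite psi0 !mnorm0 mul0r mulr0.
    rewrite (mnorm_homogeneous _ (psik j k.+1)) mulrCA ler_wpM2l ?mnorm_ge0//.
    by rewrite exprS ler_wpM2l ?(ltW s0)// ler_peMl ?exprn_ge0 ?(ltW s0)// ler1n.
  rewrite ler_wpM2l ?(ltW s0)// lef_pV2 ?posrE// ?mulr_gt0//.
  by rewrite ler_peMr// ler1n.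
pose L j := \sum_i A i j *: mpolyX R (mnm1 i).
pose CA := 1 + \sum_i \sum_j `|A i j|.
have CA0 : 0 < CA.
  by rewrite ltr_pwDl// sumr_ge0// => i _; rewrite sumr_ge0.
(* At this radius the linear part [L] has norm at most [s / 2]; with [psi_small], the iteration
   preserves the ball of norm [s]. *)
pose t := s / 2 / CA.
have s2 : 0 < s / 2 by rewrite divr_gt0.
have t0 : 0 < t by exact: divr_gt0.
have Lt j : mnorm t (L j) <= s / 2.
  rewrite (le_trans (mnorm_sum _ _ _ (ltW t0)))//.
  rewrite (@le_trans _ _ (\sum_i `|A i j| * t))//.
    apply: ler_sum => i _; rewrite (le_trans (mnormZ_le _ _ (ltW t0)))//.
    by rewrite mnormX mdeg1 expr1.
  rewrite -mulr_suml -ler_pdivlMr// /t invf_div [leRHS]mulrC mulfVK ?(gt_eqF s2)//.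
  rewrite /CA ler_wpDl//; apply: ler_sum => i _.
  by rewrite (bigD1 j)//= lerDl sumr_ge0.
(* Picard iteration with [Phi] truncated at the step number: every iterate is a polynomial, and the
   degree added at each step costs a summable error, [e] below. *)
pose P := fix P m := if m is m'.+1 then
  (fun j => L j + \sum_(0 <= k < m') mcomp (P m') (psi j k)) else fun=> 0.
have Ps m : forall j, mnorm t (P m j) <= s.
  elim: m => [|m IHm] j; first by rewrite mnorm0 ltW.
  rewrite (le_trans (mnormD _ _ (ltW t0)))// (splitr s) lerD//.
  rewrite (le_trans (mnorm_sum _ _ _ (ltW t0)))// (le_trans _ (psi_small j m))//.
  by apply: ler_sum => k _; rewrite (mnorm_mcomp _ (ltW t0) IHm).
pose D m := \sum_j mnorm t (P m.+1 j - P m j).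
have D0 m : 0 <= D m by rewrite sumr_ge0// => j _; rewrite mnorm_ge0// ltW.
have PD m j : mnorm t (P m.+1 j - P m j) <= D m.
  by rewrite /D (bigD1 j)//= lerDl sumr_ge0// => i _; rewrite mnorm_ge0// ltW.
pose e m := \sum_j mnorm s (psi j m).
have De m : D m.+1 <= e m + D m / 2.
  rewrite (@le_trans _ _ (\sum_(j < n) (mnorm s (psi j m) + (2 * n.+1%:R)^-1 * D m)))//.
    apply: ler_sum => j _.
    have -> : P m.+2 j - P m.+1 j = mcomp (P m.+1) (psi j m) +
       (\sum_(0 <= k < m) mcomp (P m.+1) (psi j k) - \sum_(0 <= k < m) mcomp (P m) (psi j k)).
      rewrite [P m.+2 j]/= [X in _ - X]/= opprD addrACA subrr add0r.
      by rewrite -/(P m.+1) big_nat_recr//= addrAC addrC.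
    rewrite (le_trans (mnormD _ _ (ltW t0)))// lerD//.
      exact: (mnorm_mcomp _ (ltW t0) (Ps m.+1)).
    rewrite (le_trans (series_lip m (psik j) (ltW t0) (ltW s0) (D0 m) (Ps m.+1) (Ps m) (PD m)))//.
    by rewrite ler_wpM2r.
  rewrite big_split/= lerD2l sumr_const card_ord -[leLHS]mulr_natr mulrAC [leLHS]mulrC ler_wpM2l//.
  by rewrite invfM -mulrA ler_piMr// ler_pdivrMl// mulr1 ler_nat.
have eE K : \sum_(0 <= m < K) e m <= \sum_(j < n) s / 2.
  by rewrite /e exchange_big/=; apply: ler_sum => j _.
have DB K : \sum_(0 <= m < K) D m <= 2 * (D 0%N + \sum_(j < n) s / 2).
  exact: contraction_sum_bound De eE.
have Pvar j K : \sum_(0 <= k < K) mnorm t (P k.+1 j - P k j) <=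
    2 * (D 0%N + \sum_(j < n) s / 2).
  by rewrite (le_trans _ (DB K))//; apply: ler_sum => k _.
move=> j; pose q m := mpolyC n (x ord0 j) + P m j.
apply: (@analytic_of_bounded_variation R n (fun y => g y ord0 j) (f x) q t
  (2 * (D 0%N + \sum_(j < n) s / 2))) => // [K|h ht].
  by rewrite (le_trans _ (Pvar j K))//; apply: ler_sum => k _; rewrite /q opprD addrACA subrr add0r.
have {}ht : `|h| <= t by apply/rV_norm_leP => //; exact: ltW.
pose v m : 'rV[R]_n := \row_i poly_eval (P m i) h.
have vs m : `|v m| <= s.
  apply/rV_norm_leP => [|i]; first exact: ltW.
  by rewrite mxE (le_trans (poly_eval_le _ ht)).
have cv i : cvgn (fun m => v m ord0 i).
  apply: bounded_variation_cvg => K; apply: le_trans (Pvar i K).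
  apply: ler_sum => k _; rewrite !mxE (_ : _ - _ = poly_eval (P k.+1 i - P k i) h).
    exact: poly_eval_le.
  by rewrite /poly_eval mevalB.
pose w : 'rV[R]_n := \row_i limn (fun m => v m ord0 i).
have vw : v @ \oo --> w by apply: cvg_rowP => i; rewrite mxE; exact: cv.
have ws : `|w| <= s := cvg_norm_le vw vs.
have wE : w = h *m A + \row_j Phi w j.
  apply/rowP => i; rewrite [RHS]mxE [X in _ + X]mxE.
  have cS := expansion_cvg (PhiE i) (fun K => le_trans (vs K) sr) (le_trans ws sr) vw.
  apply: (@cvg_unique _ _ ((fun m => v m.+1 ord0 i) @ \oo)) => //.
    have : (fun m => v m ord0 i) @ \oo --> w ord0 i by rewrite mxE; exact: cv.
    by rewrite -(cvg_shiftS (fun m => v m ord0 i)).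
  have -> : (fun m => v m.+1 ord0 i) = fun m => (h *m A) ord0 i +
      \sum_(0 <= k < m) poly_eval (psi i k) (v m).
    apply/funext => m; rewrite mxE [P m.+1 i]/= /poly_eval mevalD; congr (_ + _).
      rewrite /L raddf_sum/= mxE; apply: eq_bigr => l _.
      by rewrite mevalZ mevalXU mulrC.
    rewrite raddf_sum/=; apply: eq_bigr => k _; rewrite meval_mcomp.
    by congr (meval _ _); apply/funext => l; rewrite mxE.
  by apply: cvgD => //; exact: cvg_cst.
have fw : f x + h = f (x + w).
  move: wE; rewrite PhiP addrCA => /eqP; rewrite -subr_eq0 opprD addrA subrr sub0r oppr_eq0.
  rewrite -mulmxBl => /eqP E0.
  have := mulmxKV Ju (h - (f (x + w) - f x)); rewrite E0 mul0mx.
  by move/esym/eqP; rewrite subr_eq0 => /eqP ->; rewrite addrC subrK.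
have gw : g (f x + h) = x + w.
  by rewrite fw gf// (le_trans ws)// (le_trans _ rd)// (le_trans sr)// ler_pdivrMr// ler_pMr// ler1n.
rewrite gw mxE.
have -> : (fun k => poly_eval (q k) h) = fun k => x ord0 j + v k ord0 j.
  by apply/funext => k; rewrite /q /poly_eval mevalD mevalC mxE.
apply: cvgD; first exact: cvg_cst.
by rewrite /w mxE; exact: cv.
Qed.

End analytic_inverse.

(** * Analytic functions of one variable *)

Section analytic_fun.
Context {R : realType}.

Lemma expansion_analytic n (u : 'rV[R]_n -> R) a H r B :
  expansion (fun h => u (a + h)) H r B -> analytic_fun_at u a.
Proof.
move=> [r0 Hk HB Hu].
apply: (@analytic_of_bounded_variation R n u a (fun K => \sum_(0 <= k < K) H k) r B) => //.
  move=> K; apply: le_trans (HB K); apply: ler_sum => k _.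
  by rewrite big_nat_recr//= addrAC subrr add0r (mnorm_homogeneous _ (Hk k)).
move=> h /Hu; suff -> : series (fun k => poly_eval (H k) h) =
  (fun k => poly_eval (\sum_(0 <= k0 < k) H k0) h) by [].
by apply/funext => K; rewrite /poly_eval raddf_sum.
Qed.

Lemma eq_analytic_fun n (u v : 'rV[R]_n -> R) a : u =1 v ->
  analytic_fun_at u a -> analytic_fun_at v a.
Proof. by move=> /funext ->. Qed.

Lemma analytic_fun_mpoly n (p : mpoly n R) a : analytic_fun_at (poly_eval p) a.
Proof.
apply: (@eq_analytic_fun n (fun x => (\row_(j < 1) poly_eval p x) ord0 ord0)).
  by move=> x; rewrite mxE.
exact: (@analytic_mpoly R n 1 (fun=> p) a ord0).
Qed.

Lemma analytic_fun_cst n (c : R) (a : 'rV[R]_n) : analytic_fun_at (fun=> c) a.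
Proof.
by apply: eq_analytic_fun (analytic_fun_mpoly (mpolyC n c) a) => x; exact: mevalC.
Qed.

Lemma analytic_row n m (u : 'I_m -> 'rV[R]_n -> R) a :
  (forall j, analytic_fun_at (u j) a) ->
  real_analytic_at (fun x => \row_j u j x) a.
Proof.
move=> ua j.
by apply: (@eq_analytic_fun _ _ (fun x => (\row_j u j x) ord0 j) a _ (ua j)) => x; rewrite mxE.
Qed.

Lemma analytic_fun_continuous n (u : 'rV[R]_n -> R) a :
  analytic_fun_at u a -> {for a, continuous u}.
Proof.
move=> ua; have /analytic_continuous/continuous_rVP uc :=
  analytic_row (fun _ : 'I_1 => ua).
apply/continuous_rVP => e /uc[d d0 ud]; exists d => // h /ud.
by apply: le_trans; have := rV_coord_le ((\row__ u a) - \row_(_ < 1) u (a + h)) ord0; rewrite !mxE.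
Qed.

Lemma real_analytic_comp n m l (f : 'rV[R]_m -> 'rV[R]_l) (u : 'rV[R]_n -> 'rV[R]_m) a :
  real_analytic_at f (u a) -> real_analytic_at u a -> real_analytic_at (f \o u) a.
Proof.
by move=> fa ua j; exact: (@analytic_comp _ _ _ (fun y => f y ord0 j) u a (fa j) ua).
Qed.

(** The polynomial X_0 X_1 composed with the pair of factors. *)
Lemma analytic_funM n (u v : 'rV[R]_n -> R) a :
  analytic_fun_at u a -> analytic_fun_at v a -> analytic_fun_at (fun x => u x * v x) a.
Proof.
move=> ua va; pose w x : 'rV[R]_2 := \row_j (if j == ord0 then u x else v x).
pose p : mpoly 2 R := mpolyX R (mnm1 ord0) * mpolyX R (mnm1 ord_max).
have wa : real_analytic_at w a by apply: analytic_row => j; case: (j == ord0).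
apply: eq_analytic_fun (analytic_comp (analytic_fun_mpoly p (w a)) wa) => x /=.
by rewrite /poly_eval mevalM !mevalXU !mxE.
Qed.

Definition monomial1 k : mpoly 1 R := mpolyX R (mnm_muln (mnm1 ord0) k).

Lemma monomial1_eval k h : poly_eval (monomial1 k) h = h ord0 ord0 ^+ k.
Proof. by rewrite /poly_eval /monomial1 -mpolyXn rmorphXn/= mevalXU. Qed.

Lemma mdeg_monomial1 k : mdeg (mnm_muln (@mnm1 1 ord0) k) = k.
Proof. by rewrite mdegMn mdeg1 mul1n. Qed.

Lemma monomial1_expansion (c : nat -> R) (u : 'rV[R]_1 -> R) r B : 0 < r ->
  (forall K, \sum_(0 <= k < K) `|c k| * r ^+ k <= B) ->
  (forall h : 'rV[R]_1, `|h ord0 ord0| <= r ->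
     series (fun k => c k * h ord0 ord0 ^+ k) @ \oo --> u h) ->
  expansion u (fun k => c k *: monomial1 k) r B.
Proof.
move=> r0 cB cu; split=> // [k|K|h hr].
- by apply: homogeneousZX; exact: mdeg_monomial1.
- apply: le_trans (cB K); apply: ler_sum => k _.
  rewrite ler_wpM2r ?exprn_ge0 ?(ltW r0)//.
  by rewrite (le_trans (mnormZ_le _ _ ler01))// mnormX expr1n mulr1.
rewrite (_ : (fun k => _) = (fun k => c k * h ord0 ord0 ^+ k)); first exact: cu.
by apply/funext => k; rewrite /poly_eval mevalZ -/(poly_eval _ _) monomial1_eval.
Qed.

(** Geometric series: 1 / (a + h) is the sum of a^-1 (- h / a)^k. On the disc of radius |a| / 2 the
    ratio is at most 1/2, hence the bound 2 / |a|. *)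
Lemma analytic_fun_inv (x : 'rV[R]_1) : x ord0 ord0 != 0 ->
  analytic_fun_at (fun y : 'rV[R]_1 => (y ord0 ord0)^-1) x.
Proof.
move=> x0; set a := x ord0 ord0 in x0 *.
have a0 : 0 < `|a| by rewrite normr_gt0.
pose c k : R := a^-1 * (- a^-1) ^+ k.
have geo z : `|z| < 1 -> series (geometric a^-1 z) @ \oo --> a^-1 / (1 - z).
  exact: cvg_geometric_series.
apply: (@expansion_analytic _ _ _ (fun k => c k *: monomial1 k) (`|a| / 2) (2 * `|a|^-1)).
apply: monomial1_expansion; first by rewrite divr_gt0.
- move=> K; rewrite (_ : \sum_(_ <= k < K) _ = series (geometric `|a|^-1 (2^-1)) K).
    rewrite geometric_seriesE; last by rewrite lt_eqF// invf_lt1// ltr1n.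
    rewrite (_ : 1 - 2^-1 = 2^-1 :> R); last by lra.
    rewrite invrK /= mulrC ler_wpM2l// ler_piMr ?invr_ge0// gerBl.
  apply: eq_bigr => k _; rewrite /c /= normrM normfV normrX normrN normfV.
  by rewrite -mulrA -exprMn mulrA mulVf ?gt_eqF// mul1r.
move=> h hr; rewrite mxE -/a.
have z1 : `|- a^-1 * h ord0 ord0| < 1.
  rewrite normrM normrN normfV mulrC ltr_pdivrMr// mul1r (le_lt_trans hr)//.
  by rewrite ltr_pdivrMr// ltr_pMr// ltr1n.
have := geo _ z1; rewrite (_ : series _ = series (fun k => c k * h ord0 ord0 ^+ k)); last first.
  by congr series; apply/funext => k; rewrite /c /= exprMn mulrA.
rewrite mulNr opprK -invfM mulrDr mulr1 mulrA mulfV// mul1r; exact.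
Qed.

Lemma analytic_funV n (u : 'rV[R]_n -> R) a : u a != 0 ->
  analytic_fun_at u a -> analytic_fun_at (fun x => (u x)^-1) a.
Proof.
move=> u0 ua; have ra := analytic_row (fun _ : 'I_1 => ua).
have V : analytic_fun_at (fun y : 'rV[R]_1 => (y ord0 ord0)^-1) (\row__ u a).
  by apply: analytic_fun_inv; rewrite mxE.
by apply: eq_analytic_fun (analytic_comp V ra) => x; rewrite /= mxE.
Qed.

Lemma poly_evalZ n k (p : mpoly n R) c h : homogeneous k p ->
  poly_eval p (c *: h) = c ^+ k * poly_eval p h.
Proof.
move=> pk; rewrite !poly_evalE mulr_sumr; apply: eq_big_seq => m /pk mk.
rewrite mulrCA; congr (_ * _); rewrite !mevalX -mk mdegE -prodrXr -big_split/=.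
by apply: eq_bigr => i _; rewrite mxE exprMn.
Qed.

(** [d] is the least degree in which some [u i] has a nonzero coefficient; if there is none, all
    [u i] vanish near 0. Dividing by s^d shifts the coefficients by [d] and keeps the radius. *)
Lemma analytic_common_order (I : finType) (u : I -> 'rV[R]_1 -> R) :
  (forall i, analytic_fun_at (u i) 0) ->
  (\forall s \near (0 : 'rV[R]_1), forall i, u i s = 0) \/
  exists (d : nat) (w : I -> 'rV[R]_1 -> R),
    [/\ forall i, analytic_fun_at (w i) 0, exists i, w i 0 != 0 &
      \forall s \near (0 : 'rV[R]_1), forall i, u i s = s ord0 ord0 ^+ d * w i s].
Proof.
move=> ua.
have /expansion_family[H [r [B [r0 B0 uE]]]] :
    forall i, exists H r B, expansion (fun h => u i (0 + h)) H r B.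
  by move=> i; exact: analytic_expansion.
pose c i k := poly_eval (H i k) (const_mx 1).
have Hc i k h : poly_eval (H i k) h = c i k * h ord0 ord0 ^+ k.
  have -> : h = h ord0 ord0 *: const_mx 1.
    by apply/rowP => j; rewrite !mxE !ord1 mulr1.
  rewrite (@poly_evalZ _ k); last by case: (uE i).
  by rewrite mulrC !mxE mulr1.
have cB i K : \sum_(0 <= k < K) `|c i k| * r ^+ k <= B.
  have [_ Hk HB _] := uE i; apply: le_trans (HB K); apply: ler_sum => k _.
  rewrite ler_wpM2r ?exprn_ge0 ?(ltW r0)// /c.
  apply: poly_eval_le; apply/rV_norm_leP => // j; by rewrite mxE normr1.
have cu i (h : 'rV[R]_1) : `|h ord0 ord0| <= r ->
    series (fun k => c i k * h ord0 ord0 ^+ k) @ \oo --> u i h.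
  move=> hr; have [_ _ _ Hu] := uE i.
  have <- : (fun k => poly_eval (H i k) h) = (fun k => c i k * h ord0 ord0 ^+ k).
    by apply/funext => k; exact: Hc.
  by rewrite -[h in u i h]add0r; apply: Hu => j; rewrite (ord1 j).
have [[d dP]|nd] := pselect (exists d, [exists i, c i d != 0]); last first.
  left; apply/near_addP; exists r => // h hr i; rewrite add0r.
  apply: (@cvg_unique _ _ (series (fun k => c i k * h ord0 ord0 ^+ k) @ \oo)) => //.
    by apply: cu; rewrite (le_trans (rV_coord_le _ _)).
  rewrite (_ : series _ = fun=> 0); first exact: cvg_cst.
  apply/funext => K; rewrite /series/= big1// => k _.
  have [->|ck] := eqVneq (c i k) 0; first by rewrite mul0r.
  by exfalso; apply: nd; exists k; apply/existsP; exists i.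
right; have exd : exists d, [exists i, c i d != 0] by exists d.
case: (ex_minnP exd) => {dP}d /existsP[i0 ci0] dmin; exists d.
have c0 i k : (k < d)%N -> c i k = 0.
  move=> kd; apply/eqP; apply: contraTT kd => cik; rewrite -leqNgt.
  by apply: dmin; apply/existsP; exists i.
have shift (F : nat -> R) K : \sum_(d <= k < K + d) F k = \sum_(0 <= k < K) F (k + d)%N.
  by rewrite -{1}[d]add0n big_addn addnK.
pose w i (h : 'rV[R]_1) := limn (series (fun k => c i (k + d)%N * h ord0 ord0 ^+ k)).
have wB i K : \sum_(0 <= k < K) `|c i (k + d)%N| * r ^+ k <= B / r ^+ d.
  rewrite ler_pdivlMr ?exprn_gt0// mulr_suml (le_trans _ (cB i (K + d)%N))//.
  rewrite [leRHS](@big_cat_nat _ _ _ d)//= ?leq_addl// ler_wpDl//.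
    by rewrite sumr_ge0// => k _; rewrite mulr_ge0// exprn_ge0// ltW.
  rewrite shift; apply: ler_sum => k _.
  by rewrite exprD mulrA.
have wcv i (h : 'rV[R]_1) : `|h ord0 ord0| <= r ->
    series (fun k => c i (k + d)%N * h ord0 ord0 ^+ k) @ \oo --> w i h.
  move=> hr; rewrite /w; apply: normed_cvg; apply: nondecreasing_is_cvgn.
    by apply: nondecreasing_series => k _ _ /=.
  exists (B / r ^+ d) => _ [K _ <-]; apply: le_trans (wB i K).
  apply: ler_sum => k _ /=; rewrite normrM ler_wpM2l// normrX lerXn2r// nnegrE//.
  exact: ltW.
exists w; split=> [i||].
- apply: (@expansion_analytic _ _ _ (fun k => c i (k + d)%N *: monomial1 k) r (B / r ^+ d)).
  apply: monomial1_expansion => // h hr; rewrite add0r; exact: wcv.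
- exists i0; suff -> : w i0 0 = c i0 d by [].
  apply: (@cvg_unique _ _ (series (fun k => c i0 (k + d)%N * (0 : 'rV[R]_1) ord0 ord0 ^+ k) @ \oo)) => //.
    by apply: wcv; rewrite mxE normr0 ltW.
  apply: cvg_near_cst; exists 1%N => // -[//|K] _.
  rewrite /series/= big_nat_recl// big1 ?addr0 => [|k _]; first by rewrite mulr1.
  by rewrite mxE expr0n mulr0.
apply/near_addP; exists r => // h hr i; rewrite add0r.
have hr0 : `|h ord0 ord0| <= r by rewrite (le_trans (rV_coord_le _ _)).
apply: (@cvg_unique _ _ ((fun K => series (fun k => c i k * h ord0 ord0 ^+ k) (K + d)%N) @ \oo)) => //.
  by have := cu i h hr0; rewrite -(cvg_shiftn d).
rewrite (_ : (fun K => _) = fun K => h ord0 ord0 ^+ d * series (fun k => c i (k + d)%N * h ord0 ord0 ^+ k) K).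
  by apply: cvgMr; exact: wcv.
apply/funext => K; rewrite /series/= (@big_cat_nat _ _ _ d)//= ?leq_addl//.
rewrite big_nat_cond big1 ?add0r => [|k /andP[/andP[_ kd] _]]; last first.
  by rewrite c0// mul0r.
rewrite shift mulr_sumr; apply: eq_bigr => k _.
by rewrite exprD; ring.
Qed.

End analytic_fun.

(** * Lifting analytic arcs through blowings-up *)

Section arcs.
Context {R : realType}.

(** Only the germ at 0 matters, and a single chart is asked for. The parameter is a row of length 1
    so that [real_analytic_at] applies. *)
Definition analytic_arc {n} (M : manifold R n) (gam : 'rV[R]_1 -> M) : Prop :=
  exists c : chart R n M, [/\ analytic_chart c, cdom c (gam 0) &
    exists2 u : 'rV[R]_1 -> 'rV[R]_n, real_analytic_at u 0 &
      \forall s \near (0 : 'rV[R]_1), cdom c (gam s) /\ c (gam s) = u s].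

Lemma is_chart_near n (T : topologicalType) (c : chart R n T) p (A : set T) :
  is_chart c -> cdom c p -> nbhs p A ->
  exists2 O : set 'rV[R]_n, open O /\ O (c p) &
    forall q, cdom c q -> O (c q) -> A q.
Proof.
move=> [oc cinj _ copen] cp; rewrite nbhsE => -[B [oB Bp] BA].
exists (c @` (B `&` cdom c)).
  split; last by exists p.
  by apply: copen => [|q []//]; exact: openI.
by move=> q cq [q' [Bq' cq'] /cinj E]; rewrite -E//; exact: BA.
Qed.

Lemma analytic_arc_continuous n (M : manifold R n) (gam : 'rV[R]_1 -> M) :
  analytic_arc gam -> {for 0, continuous gam}.
Proof.
move=> [c [[cc _] c0 [u u0 cu]]] A /(is_chart_near cc c0)[Q [oQ Qc] QA].
have E : u 0 = c (gam 0) by case: (nbhs_singleton cu).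
have : \forall s \near (0 : 'rV[R]_1), Q (u s).
  apply: (analytic_continuous u0); rewrite E.
  exact: open_nbhs_nbhs.
move=> H; apply: filterS2 cu H => s [cs <-] Qs; exact: QA.
Qed.

Lemma atlas_analytic_chart n (M : manifold R n) (c : chart R n M) :
  atlas c -> analytic_chart c.
Proof.
by move=> ac; split; [exact: m_charts|move=> d ad; split; exact: m_compatible].
Qed.

(** With the identity for [f], this is the change of charts along an arc. *)
Lemma arc_read_step n m (M : manifold R n) (N : manifold R m)
    (c : chart R n M) (d : chart R m N) (f : M -> N) (gam : 'rV[R]_1 -> M) u :
  {for 0, continuous gam} -> {for gam 0, continuous f} ->
  real_analytic_at u 0 ->
  (\forall s \near (0 : 'rV[R]_1), c (gam s) = u s) ->
  open (cdom d) -> cdom d (f (gam 0)) ->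
  analytic_read c d f (gam 0) ->
  exists2 v, real_analytic_at v 0 &
     \forall s \near (0 : 'rV[R]_1), cdom d (f (gam s)) /\ d (f (gam s)) = v s.
Proof.
move=> gc fc u0 cu od d0 [t [t0 tn]].
exists (t \o u).
  by apply: real_analytic_comp u0; rewrite -(nbhs_singleton cu).
have H1 : \forall s \near (0 : 'rV[R]_1), cdom d (f (gam s)).
  have : nbhs (f (gam 0)) (cdom d) by exact: open_nbhs_nbhs.
  by move=> /fc /gc.
have H2 : \forall s \near (0 : 'rV[R]_1), t (c (gam s)) = d (f (gam s)).
  exact: gc tn.
apply: filterS3 cu H1 H2 => s E ds Et; split=> //.
by rewrite -Et E.
Qed.

Lemma arc_read n (M : manifold R n) (gam : 'rV[R]_1 -> M) (d : chart R n M) :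
  analytic_arc gam -> analytic_chart d -> cdom d (gam 0) ->
  exists2 u, real_analytic_at u 0 &
    \forall s \near (0 : 'rV[R]_1), cdom d (gam s) /\ d (gam s) = u s.
Proof.
move=> ga ad d0; have gc := analytic_arc_continuous ga.
case: ga => c [ac c0 [u u0 cu]].
(* By definition an [analytic_chart] is compatible with the charts of the atlas, so the change from
   [c] to [d] passes through an atlas chart [e]. *)
have [e ae e0] := m_cover (gam 0).
have idc : {for gam 0, continuous (@id M)} by exact: cvg_id.
have cu' : \forall s \near (0 : 'rV[R]_1), c (gam s) = u s.
  by apply: filterS cu => s [].
have [v v0 ev] : exists2 v, real_analytic_at v 0 &
    \forall s \near (0 : 'rV[R]_1), cdom e (gam s) /\ e (gam s) = v s.
  apply: (arc_read_step gc idc u0 cu' _ e0).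
    by case: (m_charts ae).
  by case: ac => _ /(_ _ ae)[+ _]; exact.
have ev' : \forall s \near (0 : 'rV[R]_1), e (gam s) = v s.
  by apply: filterS ev => s [].
apply: (arc_read_step gc idc v0 ev' _ d0).
  by case: ad => -[].
by case: ad => _ /(_ _ ae)[_]; exact.
Qed.

Lemma analytic_arc_comp n m (M : manifold R n) (N : manifold R m) (f : M -> N)
    (gam : 'rV[R]_1 -> M) :
  analytic_at f (gam 0) -> analytic_arc gam -> analytic_arc (f \o gam).
Proof.
move=> [fc fr] ga; have gc := analytic_arc_continuous ga.
have [c ac c0] := m_cover (gam 0); have [d ad d0] := m_cover (f (gam 0)).
exists d; split=> //; first exact: atlas_analytic_chart.
have [u u0 cu] := arc_read ga (atlas_analytic_chart ac) c0.
have cu' : \forall s \near (0 : 'rV[R]_1), c (gam s) = u s.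
  by apply: filterS cu => s [].
have od : open (cdom d) by case: (m_charts ad).
exact: (arc_read_step gc fc u0 cu' od d0 (fr _ _ ac ad c0 d0)).
Qed.

Lemma analytic_arc_near n (M : manifold R n) (gam del : 'rV[R]_1 -> M) :
  (\forall s \near (0 : 'rV[R]_1), gam s = del s) ->
  analytic_arc gam -> analytic_arc del.
Proof.
move=> gd [c [ac c0 [u u0 cu]]]; exists c; split=> //.
  by rewrite -(nbhs_singleton gd).
by exists u => //; apply: filterS2 gd cu => s <-.
Qed.

End arcs.

Section lift.
Context {R : realType} {n : nat}.

Lemma lift_arc_iso (M' M : manifold R n) (b : M' -> M) (A : set M') (B : set M)
    (gam : 'rV[R]_1 -> M) : open B -> analytic_iso_on A B b -> B (gam 0) ->
  analytic_arc gam ->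
  exists2 del, analytic_arc del & \forall s \near (0 : 'rV[R]_1),
    A (del s) /\ b (del s) = gam s.
Proof.
move=> oB [_ [h [_ hB]]] B0 ga; exists (h \o gam).
  by apply: analytic_arc_comp ga; case: (hB _ B0).
have nB : nbhs (gam 0) B by exact: open_nbhs_nbhs.
have gB : \forall s \near (0 : 'rV[R]_1), B (gam s).
  exact: (analytic_arc_continuous ga nB).
apply: filterS gB => s Bs /=.
by case: (hB _ Bs).
Qed.

(* Along an analytic arc through the center, the first [k] coordinates have a
   common factor [s ^+ d]; dividing by it gives homogeneous coordinates of the
   lifted arc which do not vanish at [0]. If these coordinates all vanish, any
   direction may be chosen. *)
Lemma homogeneous_coordinates k (x : 'rV[R]_1 -> 'rV[R]_n) : (k < n)%N ->
  real_analytic_at x 0 ->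
  exists (i0 : 'I_n) (w : 'I_n -> 'rV[R]_1 -> R),
    [/\ (i0 <= k)%N, w i0 0 != 0, forall i, analytic_fun_at (w i) 0 &
      \forall s \near (0 : 'rV[R]_1), forall i j : 'I_n, (i <= k)%N -> (j <= k)%N ->
        x s ord0 i * w j s = x s ord0 j * w i s].
Proof.
move=> kn x0; pose u (i : 'I_k.+1) s := x s ord0 (widen_ord kn i).
have ua i : analytic_fun_at (u i) 0 by exact: x0.
have wi (i : 'I_n) : (i <= k)%N -> widen_ord kn (inord i) = i.
  by move=> ik; apply/val_inj; rewrite /= inordK.
have [u0|[d [w [wa [i0 wi0] uw]]]] := analytic_common_order ua.
  exists (widen_ord kn ord0), (fun i _ => (i == widen_ord kn ord0)%:R); split=> //.
  - by rewrite eqxx oner_neq0.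
  - by move=> i; exact: analytic_fun_cst.
  apply: filterS u0 => s us i j ik jk.
  by rewrite -[in x s ord0 i](wi i)// -[in x s ord0 j](wi j)// -!/(u _ _) !us !mul0r.
exists (widen_ord kn i0), (fun i => w (inord i)); split=> //.
- by rewrite /= -ltnS.
- by rewrite /= inord_val.
apply: filterS uw => s us i j ik jk.
rewrite -[in x s ord0 i](wi i)// -[in x s ord0 j](wi j)// -!/(u _ _) !us.
by rewrite -!mulrA [w _ _ * w _ _]mulrC.
Qed.

(** Off the center the isomorphism lifts the arc. Through the center, the direction [xi] singles out
    one point of each fibre, and the affine chart [i0], where [w i0 0 != 0], reads the lift through
    ratios of analytic functions. *)
Lemma lift_arc_blowup (M' M : manifold R n) (b : M' -> M) (C : set M)
    (gam : 'rV[R]_1 -> M) :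
  nonsingular C -> nowhere_dense C -> blowup b C -> analytic_arc gam ->
  exists2 del, analytic_arc del & \forall s \near (0 : 'rV[R]_1), b (del s) = gam s.
Proof.
move=> [cC _] ndC [isoC blC] ga.
have [C0|nC0] := pselect (C (gam 0)); last first.
  have [del da dg] := lift_arc_iso (closed_openC cC) isoC nC0 ga.
  by exists del => //; apply: filterS dg => s [].
have [c [k [c0 [ac kn Cc] [L [Linc Luniq Lchart]]]]] := blC _ C0.
have [oc _ _ _] := ac.1.
(* With [k = 0] the center would contain the whole chart domain, against nowhere density. Afterwards
   the codimension is [k.+1], so [j <= k] selects the coordinates transverse to the center. *)
case: k kn Cc Linc Luniq Lchart => [_ Cc|k kn _ Linc Luniq Lchart].
  exfalso; have : interior (closure C) (gam 0).
    apply: filterS (open_nbhs_nbhs (conj oc c0)) => p cp.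
    by apply: subset_closure; apply/(Cc _ cp).
  by rewrite ndC.
have [x x0 cx] := arc_read ga ac c0.
have [i0 [w [i0k wi0 wa xw]]] := homogeneous_coordinates kn x0.
pose xi s : 'rV[R]_n := \row_j (if (j <= k)%N then w j s else 0).
have wn0 : \forall s \near (0 : 'rV[R]_1), w i0 s != 0.
  have wc := analytic_fun_continuous (wa i0).
  have nW : nbhs (w i0 0) [set y : R | y != 0].
    by apply: open_nbhs_nbhs; split => //; exact: open_neq.
  exact: (wc _ nW).
have good : \forall s \near (0 : 'rV[R]_1), [/\ cdom c (gam s), c (gam s) = x s,
    w i0 s != 0 & incident k.+1 (c (gam s)) (xi s)].
  apply: filterS3 cx wn0 xw => s [cs cxs] ws xws; split=> //; split.
  - apply/eqP => /rowP /(_ i0); rewrite !mxE i0k => /eqP; exact/negP.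
  - by move=> i; rewrite ltnNge mxE => /negbTE ->.
  - move=> i j; rewrite !ltnS => ik jk; rewrite !mxE ik jk cxs; exact: xws.
have /choice[del delP] : forall s, exists p, [/\ cdom c (gam s), c (gam s) = x s,
    w i0 s != 0 & incident k.+1 (c (gam s)) (xi s)] ->
    b p = gam s /\ exists t : R, L p = t *: xi s.
  move=> s; have [[g1 g2 g3 g4]|ng] := pselect [/\ cdom c (gam s), c (gam s) = x s,
      w i0 s != 0 & incident k.+1 (c (gam s)) (xi s)].
    by have [p [pP _]] := Luniq _ _ g1 g4; exists p.
  (* Where the conditions fail any point serves as a default; the fibre over [gam 0] provides
     one. *)
  have [g1 g2 g3 g4] := nbhs_singleton good.
  by have [p _] := Luniq _ _ g1 g4; exists p.
exists del; last by apply: filterS good => s /delP[].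
pose c' := Chart [set p : M' | cdom c (b p) /\ L p ord0 i0 != 0]
            (fun p => \row_j (if (j < k.+1)%N && (j != i0)
                              then L p ord0 j / L p ord0 i0
                              else c (b p) ord0 j)).
have key : \forall s \near (0 : 'rV[R]_1), cdom c' (del s) /\ c' (del s) =
    \row_j (if (j <= k)%N && (j != i0) then w j s * (w i0 s)^-1 else x s ord0 j).
  apply: filterS good => s gs; have [bs [t Lt]] := delP s gs.
  case: gs => g1 g2 g3 g4.
  (* [L] is known only up to the scalar [t]. Homogeneous coordinates are not all zero, so [t] is
     nonzero and cancels in the ratios of the chart. *)
  have t0 : t != 0.
    have := Linc (del s); rewrite bs Lt => /(_ g1)[+ _ _].
    by apply: contra => /eqP ->; rewrite scale0r.
  split; first by rewrite /= bs Lt !mxE i0k mulf_neq0.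
  apply/rowP => j; rewrite !mxE bs g2 Lt !mxE ltnS i0k.
  case: ifP => // /andP[jk _]; rewrite jk.
  by field; rewrite t0 g3.
exists c'; split; first exact: (Lchart i0 i0k).
  by case: (nbhs_singleton key).
eexists; last exact: key.
apply: analytic_row => j; case: ((j <= k)%N && (j != i0)); last exact: x0.
apply: analytic_funM; first exact: wa.
by apply: analytic_funV.
Qed.

Lemma lift_arc_tower (M : manifold R n) (X : nat -> manifold R n)
    (b : forall j, stage M X j.+1 -> stage M X j) (C : forall j, set (stage M X j))
    (gam : 'rV[R]_1 -> M) j :
  (forall j, [/\ nonsingular (C j), nowhere_dense (C j) & blowup (b j) (C j)]) ->
  analytic_arc gam ->
  exists2 del : 'rV[R]_1 -> stage M X j, analytic_arc del &
    \forall s \near (0 : 'rV[R]_1), to_base b (del s) = gam s.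
Proof.
move=> blC ga; elim: j => [|j [del da dg]]; first by exists gam => //; apply: filterE => s; exact: erefl.
have [nC dC bC] := blC j.
have [del' da' dd'] := lift_arc_blowup nC dC bC da.
by exists del' => //; apply: filterS2 dg dd' => s <- /= ->.
Qed.

Lemma to_base_thread (T : Type) (M : manifold R n) (X : nat -> manifold R n)
    (b : forall j, stage M X j.+1 -> stage M X j) (p : forall j, T -> stage M X j) :
  (forall j y, b j (p j.+1 y) = p j y) -> forall j y, to_base b (p j y) = p 0%N y.
Proof. by move=> bp; elim=> [//|j IHj] y /=; rewrite bp IHj. Qed.

(** Over a neighbourhood [W] of the base point the tower is complete at stage [J]: the arc is lifted
    through [J] blowings-up and then carried to [Mt] by the inverse of [p J]. *)
Lemma lift_arc (Mt M : manifold R n) (pi : Mt -> M) (gam : 'rV[R]_1 -> M) :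
  locally_finite_blowups pi -> analytic_arc gam ->
  exists2 del, analytic_arc del & \forall s \near (0 : 'rV[R]_1), pi (del s) = gam s.
Proof.
move=> [X [b [C [p [blC p0 bp lf]]]]] ga.
have [W [J [oW W0 /(_ _ (leqnn J))[_ iso]]]] := lf (gam 0).
have [del da dg] := lift_arc_tower J blC ga.
have d0 : to_base b (del 0) = gam 0 := nbhs_singleton dg.
case: iso => _ [h [_ hW]].
have Wd0 : (@to_base R n M X b J @^-1` W) (del 0) by rewrite /= d0.
exists (h \o del); first by apply: analytic_arc_comp da; case: (hW _ Wd0).
have nW : nbhs (gam 0) W by exact: open_nbhs_nbhs.
have gW : \forall s \near (0 : 'rV[R]_1), W (gam s).
  exact: (analytic_arc_continuous ga nW).
apply: filterS2 gW dg => s Ws ds /=.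
have [|_ _ hs] := hW (del s); first by rewrite /= ds.
by rewrite -p0 -(to_base_thread bp J) hs.
Qed.

Lemma blow_analytic_arc m (M : manifold R n) (N : manifold R m) (f : M -> N)
    (gam : 'rV[R]_1 -> M) :
  blow_analytic f -> analytic_arc gam -> analytic_arc (f \o gam).
Proof.
move=> [Mt [pi [piP fpi]]] ga; have [del da dg] := lift_arc piP ga.
apply: analytic_arc_near (analytic_arc_comp (fpi (del 0)) da).
by apply: filterS dg => s /= ->.
Qed.

End lift.

(** * Blow-analytic maps along lines *)

Section lines.
Context {R : realType} {n : nat}.

Lemma euclidean_arc m (gam : 'rV[R]_1 -> euclidean R m) :
  analytic_arc gam -> real_analytic_at (gam : 'rV[R]_1 -> 'rV[R]_m) 0.
Proof.
move=> ga; pose c : chart R m (euclidean R m) := Chart [set: 'rV[R]_m] id.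
have ac : @atlas R m (euclidean R m) c by [].
have [u u0 cu] := arc_read ga (atlas_analytic_chart ac) I.
by apply: analytic_near_eq u0; apply: filterS cu => s [].
Qed.

Lemma line_analytic (y v : 'rV[R]_n) :
  real_analytic_at (fun s : 'rV[R]_1 => y + s ord0 ord0 *: v) 0.
Proof.
pose p j : mpoly 1 R := mpolyC 1 (y ord0 j) + v ord0 j *: mpolyX R (mnm1 ord0).
have E : (fun s : 'rV[R]_1 => y + s ord0 ord0 *: v) = fun s => \row_j poly_eval (p j) s.
  apply/funext => s; apply/rowP => j.
  by rewrite !mxE /poly_eval /p mevalD mevalC mevalZ mevalXU mulrC.
by rewrite E; exact: analytic_mpoly.
Qed.

Lemma submanifold_arc (V : set 'rV[R]_n) (oV : open V) (y v : 'rV[R]_n) : V y ->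
  exists2 gam : 'rV[R]_1 -> open_submanifold oV, analytic_arc gam &
    \forall s \near (0 : 'rV[R]_1), set_val (gam s : V) = y + s ord0 ord0 *: v.
Proof.
move=> Vy; pose l (s : 'rV[R]_1) := y + s ord0 ord0 *: v.
have lc := analytic_continuous (line_analytic y v).
have l0 : l 0 = y by rewrite /l mxE scale0r addr0.
have Vl : \forall s \near (0 : 'rV[R]_1), V (l s).
  by apply: lc; rewrite -/(l 0) l0; exact: open_nbhs_nbhs.
have /choice[gam gamP] : forall s, exists p : V, V (l s) -> set_val p = l s.
  move=> s; have [Vs|nV] := pselect (V (l s)).
    by exists (SigSub (mem_set Vs)).
  (* Parameters at which the line has left [V] are sent to [y]. *)
  by exists (SigSub (mem_set Vy)).
exists gam; last by apply: filterS Vl => s /gamP.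
pose c : chart R n (open_submanifold oV) := Chart [set: V] set_val.
have ac : @atlas R n (open_submanifold oV) c by [].
exists c; split; [exact: atlas_analytic_chart|by []|].
exists l; first exact: line_analytic.
by apply: filterS Vl => s /gamP.
Qed.

Lemma blow_analytic_line m (g : 'rV[R]_n -> 'rV[R]_m) V (oV : open V) y v : V y ->
  blow_analytic (M := open_submanifold oV) (N := euclidean R m)
    (g \o (set_val : V -> 'rV[R]_n)) ->
  real_analytic_at (fun s : 'rV[R]_1 => g (y + s ord0 ord0 *: v)) 0.
Proof.
move=> Vy gb; have [gam ga gl] := submanifold_arc oV v Vy.
have := euclidean_arc (blow_analytic_arc gb ga).
by apply: analytic_near_eq; apply: filterS gl => s /= ->.
Qed.

End lines.

(** * The inverse function theorem in the class C^k *)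

Section fderiv_calculus.
Context {R : realType}.

Lemma fderiv_is_derive n m (f : 'rV[R]_n -> 'rV[R]_m) x J v : fderiv f x J ->
  is_derive x v f (v *m J).
Proof.
move=> fJ; have H : (fun h : R => h^-1 *: ((f \o shift x) (h *: v) - f x)) @ 0^' --> v *m J.
  apply/cvgrPdist_le => e e0.
  (* The summand 1 keeps the denominator positive when [v] is 0. *)
  have e1 : 0 < e / (1 + `|v|) by rewrite divr_gt0// ltr_pwDl.
  have [d d0 fd] := fJ _ e1.
  have d1 : 0 < d / (1 + `|v|) by rewrite divr_gt0// ltr_pwDl.
  near=> h.
  have h0 : h != 0 by near: h; exact: nbhs_dnbhs_neq.
  have hd : `|h| <= d / (1 + `|v|) by near: h; exact: dnbhs0_le.
  have hv : `|h *: v| <= d.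
    rewrite normrZ (le_trans (ler_wpM2r (normr_ge0 _) hd))// -mulrA ler_piMr ?(ltW d0)//.
    by rewrite mulrC ler_pdivrMr ?ltr_pwDl// mul1r lerDr.
  rewrite /= distrC (_ : _ - _ = h^-1 *: (f (x + h *: v) - f x - (h *: v) *m J)); last first.
    by rewrite [RHS]scalerBr -scalemxAl scalerA mulVf// scale1r [x + _]addrC.
  rewrite normrZ normfV mulrC ler_pdivrMr ?normr_gt0//.
  rewrite (le_trans (fd _ hv))// normrZ mulrCA [leRHS]mulrC ler_wpM2l//.
  by rewrite mulrAC ler_pdivrMr ?ltr_pwDl// ler_wpM2l ?(ltW e0)// lerDr.
apply: DeriveDef; first by apply/cvg_ex; exists (v *m J).
exact: (cvg_lim _ H).
Unshelve. all: by end_near. Qed.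

Lemma fderiv_unique n m (f : 'rV[R]_n -> 'rV[R]_m) x A B :
  fderiv f x A -> fderiv f x B -> A = B.
Proof.
move=> fA fB; apply/row_matrixP => i; rewrite !rowE.
have /@derive_val <- := fderiv_is_derive (delta_mx ord0 i) fA.
by have /@derive_val <- := fderiv_is_derive (delta_mx ord0 i) fB.
Qed.

Lemma fderiv_near_eq n m (f g : 'rV[R]_n -> 'rV[R]_m) x A :
  (\forall y \near x, f y = g y) -> fderiv f x A -> fderiv g x A.
Proof.
move=> /near_addP[d d0 fg] fA e /fA[d' d'0 fd]; exists (Num.min d d').
  by rewrite lt_min d0.
move=> h; rewrite le_min => /andP[hd hd'].
have E0 : f x = g x by have := fg 0; rewrite normr0 addr0; apply; exact: ltW.
by rewrite -E0 -fg//; apply: fd.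
Qed.

Lemma fderiv_comp n m l (u : 'rV[R]_n -> 'rV[R]_m) (f : 'rV[R]_m -> 'rV[R]_l) x A B :
  fderiv u x A -> fderiv f (u x) B -> fderiv (f \o u) x (A *m B).
Proof.
move=> uA fB e e0.
have [CA CA0 AC] := mulmx_norm_le A; have [CB CB0 BC] := mulmx_norm_le B.
pose e1 := e / 2 / (1 + CA); have C1 : 0 < 1 + CA by rewrite addr_gt0.
have e10 : 0 < e1 by rewrite !divr_gt0.
have [d1 d10 fd] := fB _ e10.
(* The bound 1 keeps the increment of [u] within (1 + CA) |h|; the bound e / 2 / CB makes the error
   of [u], pushed through [B], at most e |h| / 2. *)
pose e2 := Num.min 1 (e / 2 / CB).
have e20 : 0 < e2 by rewrite lt_min ltr01 !divr_gt0.
have [d2 d20 ud] := uA _ e20.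
exists (Num.min d2 (d1 / (1 + CA))); first by rewrite lt_min d20 divr_gt0.
move=> h; rewrite le_min => /andP[hd2]; rewrite ler_pdivlMr// => hd1.
pose k := u (x + h) - u x.
have ku : `|k - h *m A| <= e2 * `|h| := ud h hd2.
have k1 : `|k| <= (1 + CA) * `|h|.
  rewrite -(subrK (h *m A) k) (le_trans (ler_normD _ _))// mulrDl lerD//.
  by rewrite (le_trans ku)// ler_wpM2r// ge_min lexx.
have kd : `|k| <= d1 by rewrite (le_trans k1)// mulrC.
have uk : u x + k = u (x + h) by rewrite /k addrC subrK.
have := fd k kd; rewrite uk => fk.
rewrite /= mulmxA -(subrKA (k *m B)) (le_trans (ler_normD _ _))//.
rewrite (splitr e) mulrDl lerD//.
  rewrite (le_trans fk)// (le_trans (ler_wpM2l (ltW e10) k1))//.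
  by rewrite mulrA /e1 divfK ?gt_eqF.
rewrite -mulmxBl (le_trans (BC _))// (le_trans (ler_wpM2l (ltW CB0) ku))//.
by rewrite mulrA ler_wpM2r// mulrC -ler_pdivlMr// ge_min lexx orbT.
Qed.

(* [h = g (y + k) - g y] satisfies [k = h *m J + o(h)], so [|h| = O(|k|)]. *)
Lemma fderiv_inverse n (f g : 'rV[R]_n -> 'rV[R]_n) y J :
  {for y, continuous g} -> (\forall z \near y, f (g z) = z) ->
  fderiv f (g y) J -> J \in unitmx -> fderiv g y (invmx J).
Proof.
move=> gc /near_addP[d0 d00 fg] fJ Ju e e0.
have [C C0 CJ] := mulmx_norm_le (invmx J).
(* The bound 1/2 lets the error be absorbed into the left side, giving |h| <= 2 C |k|; with this, e
   / 2 / C yields the final error e |k|. Dividing by [C] anticipates the factor lost to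
   [invmx J]. *)
pose e1 := Num.min (1 / 2) (e / 2 / C) / C.
have e10 : 0 < e1 by rewrite divr_gt0// lt_min !divr_gt0.
have [d1 d10 fd] := fJ _ e10.
have /continuous_rVP /(_ _ d10) [d2 d20 gd] := gc.
exists (Num.min d0 d2); first by rewrite lt_min d00.
move=> k; rewrite le_min => /andP[kd0 kd2].
pose h := g (y + k) - g y.
have hd : `|h| <= d1 by rewrite distrC; exact: gd.
have fy : f (g y) = y by have := fg 0; rewrite normr0 addr0; apply; exact: ltW.
have gh : g y + h = g (y + k) by rewrite /h addrC subrK.
have yk : y + k - y = k by rewrite addrAC subrr add0r.
have := fd h hd; rewrite gh fg// fy yk => kh.
have hk : `|h - k *m invmx J| <= C * (e1 * `|h|).
  rewrite distrC -{1}(mulmxK Ju h) -mulmxBl.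
  by rewrite (le_trans (CJ _))// ler_wpM2l// ltW.
have h2 : `|h| <= 2 * (C * `|k|).
  have : `|h| <= 1 / 2 * `|h| + C * `|k|.
    rewrite -{1}(subrK (k *m invmx J) h) (le_trans (ler_normD _ _))// lerD ?CJ//.
    rewrite (le_trans hk)// mulrA ler_wpM2r// /e1 mulrC divfK ?gt_eqF//.
    by rewrite ge_min lexx.
  lra.
rewrite -/h (le_trans hk)// mulrA (_ : C * e1 = Num.min (1 / 2) (e / 2 / C)); last first.
  by rewrite /e1 mulrC divfK ?gt_eqF.
have m0 : 0 <= Num.min (1 / 2) (e / 2 / C) by rewrite le_min !divr_ge0// ltW.
rewrite (le_trans (ler_wpM2l m0 h2))//.
rewrite (@le_trans _ _ (e / 2 / C * (2 * (C * `|k|))))//.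
  by rewrite ler_wpM2r ?mulr_ge0 ?(ltW C0)// ge_min lexx orbT.
by rewrite le_eqVlt; apply/orP; left; apply/eqP; field; rewrite gt_eqF.
Qed.

Lemma mean_value_line n (u : 'rV[R]_n -> R) z v t :
  (forall s, `|s| <= `|t| -> derivable u (z + s *: v) v) ->
  exists2 s, `|s| <= `|t| & u (z + t *: v) - u z = t * 'D_v u (z + s *: v).
Proof.
move=> du; pose phi (s : R) := u (z + s *: v).
have dphi (s : R) : `|s| <= `|t| -> is_derive s 1 phi ('D_v u (z + s *: v)).
  move=> st; have E : (fun h : R => h^-1 *: ((phi \o shift s) (h *: 1) - phi s)) =
      (fun h : R => h^-1 *: ((u \o shift (z + s *: v)) (h *: v) - u (z + s *: v))).
    by apply/funext => h; rewrite /phi /= /shift/= [h *: 1]mulr1 scalerDl addrCA.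
  by apply: DeriveDef; rewrite /derivable /derive E//; exact: du.
have phi0 : phi 0 = u z by rewrite /phi scale0r addr0.
have cont a b : (forall s, s \in `[a, b] -> `|s| <= `|t|) ->
    {within `[a, b], continuous phi}.
  move=> ab; apply: derivable_within_continuous => s /ab /dphi ds.
  exact: ex_derive.
have [t0|t0] := leP 0 t.
  have tt s : s \in `[0, t] -> `|s| <= `|t|.
    by rewrite in_itv/= => /andP[s0 st]; rewrite !ger0_norm.
  have [|s st E] := MVT_segment (f := phi) (df := fun s => 'D_v u (z + s *: v)) t0 _ (cont _ _ tt).
    by move=> s st; apply: dphi; apply: tt; apply: subset_itv_oo_cc.
  exists s; first exact: tt.
  by rewrite -phi0 -/(phi t) E subr0 mulrC.
have tt s : s \in `[t, 0] -> `|s| <= `|t|.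
  by rewrite in_itv/= => /andP[s0 st]; rewrite !ler0_norm ?lerN2// ltW.
have [|s st E] := MVT_segment (f := phi) (df := fun s => 'D_v u (z + s *: v)) (ltW t0) _ (cont _ _ tt).
  by move=> s st; apply: dphi; apply: tt; apply: subset_itv_oo_cc.
exists s; first exact: tt.
by rewrite -phi0 -/(phi t) -opprB E sub0r mulrN opprK mulrC.
Qed.

(** The increment is split along an axis-parallel path from [x] to [x + h], with vertices [x + p k].
    The mean value theorem applies on each edge, and continuity of the partial derivatives replaces
    their values there by those at [x]. *)
Lemma partials_fderiv n (u : 'rV[R]_n -> R) x :
  (\forall y \near x, forall i : 'I_n, derivable u y (delta_mx ord0 i)) ->
  (forall i : 'I_n, {for x, continuous ('D_(delta_mx ord0 i) u)}) ->
  forall e, 0 < e -> exists2 d, 0 < d & forall h, `|h| <= d ->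
    `|u (x + h) - u x - \sum_i h ord0 i * 'D_(delta_mx ord0 i) u x| <= e * `|h|.
Proof.
move=> /near_addP[d0 d00 du] Dc e e0.
(* Each of the [n] edges contributes an error at most e1 |h|; [n.+1] avoids a division by 0 when [n]
   is 0. *)
pose e1 := e / n.+1%:R; have e10 : 0 < e1 by rewrite divr_gt0.
have Dn i := (continuous_rVP _ _).1 (Dc i) _ e10.
have : \forall y \near x, forall i : 'I_n,
    `|'D_(delta_mx ord0 i) u x - 'D_(delta_mx ord0 i) u y| <= e1.
  apply: (@filter_forall _ _ (fun (i : 'I_n) (y : 'rV[R]_n) => `|'D_(delta_mx ord0 i) u x - 'D_(delta_mx ord0 i) u y| <= e1) (nbhs x) _).
  by move=> i; apply/near_addP; exact: Dn.
move=> /near_addP[d1 d10 D1].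
exists (Num.min d0 d1); first by rewrite lt_min d00.
move=> h; rewrite le_min => /andP[hd0 hd1].
pose p k : 'rV[R]_n := \row_i (if (i < k)%N then h ord0 i else 0).
have pS (i : 'I_n) : p i.+1 = p i + h ord0 i *: delta_mx ord0 i.
  apply/rowP => j; rewrite !mxE eqxx/= ltnS leq_eqVlt (inj_eq val_inj).
  case: (eqVneq j i) => [->|ji]; first by rewrite ltnn mulr1 add0r.
  by rewrite mulr0 addr0.
have pn : p n = h by apply/rowP => j; rewrite mxE ltn_ord.
have p0 : p 0%N = 0 by apply/rowP => j; rewrite !mxE.
have pts (i : 'I_n) s : `|s| <= `|h ord0 i| -> `|p i + s *: delta_mx ord0 i| <= `|h|.
  move=> si; apply/rV_norm_leP => // j; rewrite !mxE eqxx/=.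
  case: (eqVneq j i) => [->|ji].
    by rewrite ltnn mulr1 add0r (le_trans si)// rV_coord_le.
  by rewrite mulr0 addr0; case: ifP => _; rewrite ?normr0// rV_coord_le.
have step (i : 'I_n) : `|u (x + p i.+1) - u (x + p i) - h ord0 i * 'D_(delta_mx ord0 i) u x|
    <= e1 * `|h|.
  have [s si] : exists2 s, `|s| <= `|h ord0 i| &
      u (x + p i + h ord0 i *: delta_mx ord0 i) - u (x + p i) =
      h ord0 i * 'D_(delta_mx ord0 i) u (x + p i + s *: delta_mx ord0 i).
    apply: mean_value_line => s si; rewrite -addrA; apply: du.
    by rewrite (le_trans (pts _ _ si)).
  rewrite pS addrA => ->; rewrite -mulrBr normrM mulrC ler_pM ?rV_coord_le//.
  by rewrite distrC -addrA; apply: D1; rewrite (le_trans (pts _ _ si)).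
have -> : u (x + h) - u x = \sum_(i < n) (u (x + p i.+1) - u (x + p i)).
  rewrite -(big_mkord xpredT (fun i => u (x + p i.+1) - u (x + p i))).
  by rewrite telescope_sumr// pn p0 addr0.
rewrite -sumrB (le_trans (ler_norm_sum _ _ _))//.
rewrite (le_trans (ler_sum _ (fun i _ => step i)))// sumr_const card_ord.
rewrite -[leLHS]mulr_natr mulrAC ler_wpM2r// /e1 -mulrA ler_piMr ?(ltW e0)//.
by rewrite ler_pdivrMl// mulr1 ler_nat.
Qed.

End fderiv_calculus.

(** * Calculus of C^k functions, component by component *)

Section Ck_scalar.
Context {R : realType}.

(** Scalar counterpart of [Ck_on]: products and inverses make sense for real-valued functions, and
    [Ck_on_coord] transfers the results to maps. *)
Fixpoint Ck_fun {n} k (U : set 'rV[R]_n) (u : 'rV[R]_n -> R) : Prop :=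
  match k with
  | 0 => continuous_on U u
  | k'.+1 => continuous_on U u /\
      forall i : 'I_n, let e : 'rV[R]_n := delta_mx ord0 i in
        (forall x, U x -> derivable u x e) /\ Ck_fun k' U ('D_e u)
  end.

Lemma near_eq_continuous n (V : normedModType R) (u v : 'rV[R]_n -> V) x :
  (\forall y \near x, u y = v y) -> {for x, continuous u} -> {for x, continuous v}.
Proof.
move=> uv /continuous_rVP uc; have E := nbhs_singleton uv.
have /near_addP[d d0 dP] := uv.
apply/continuous_rVP => e /uc[d' d'0 d'P]; exists (Num.min d d').
  by rewrite lt_min d0.
by move=> h; rewrite le_min => /andP[hd hd']; rewrite -E -dP// d'P.
Qed.

Lemma continuous_coord n m (f : 'rV[R]_n -> 'rV[R]_m) x j :
  {for x, continuous f} -> {for x, continuous (fun y => f y ord0 j)}.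
Proof.
move=> /continuous_rVP fc; apply/continuous_rVP => e /fc[d d0 dP]; exists d => // h hd.
by have := rV_coord_le (f x - f (x + h)) j; rewrite !mxE => /le_trans; apply; exact: dP.
Qed.

Lemma continuous_rV_comp n m (V : normedModType R) (g : 'rV[R]_n -> 'rV[R]_m)
    (phi : 'rV[R]_m -> V) x :
  {for x, continuous g} -> {for g x, continuous phi} -> {for x, continuous (phi \o g)}.
Proof. by move=> gc pc; exact: continuous_comp. Qed.

Lemma open_near_eq n (V : Type) (U : set 'rV[R]_n) (u v : 'rV[R]_n -> V) x :
  open U -> (forall y, U y -> u y = v y) -> U x -> \forall y \near x, u y = v y.
Proof. by move=> oU uv Ux; exact: (filterS uv (open_nbhs_nbhs (conj oU Ux))). Qed.

Lemma Ck_fun_continuous n k (U : set 'rV[R]_n) u : Ck_fun k U u -> continuous_on U u.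
Proof. by case: k => [//|k []]. Qed.

Lemma eq_Ck_fun n k (U : set 'rV[R]_n) u v : open U ->
  (forall x, U x -> u x = v x) -> Ck_fun k U u -> Ck_fun k U v.
Proof.
move=> oU; elim: k u v => [|k IHk] u v uv /=.
  by move=> uc x Ux; apply: near_eq_continuous (uc x Ux); exact: open_near_eq Ux.
move=> [uc ud]; split.
  by move=> x Ux; apply: near_eq_continuous (uc x Ux); exact: open_near_eq Ux.
move=> i; have [d1 d2] := ud i; split=> [x Ux|].
  by apply: near_eq_derivable (d1 x Ux); exact: open_near_eq Ux.
apply: IHk d2 => x Ux; apply: near_eq_derive; exact: open_near_eq Ux.
Qed.

Lemma Ck_funW n k (U : set 'rV[R]_n) u : Ck_fun k.+1 U u -> Ck_fun k U u.
Proof.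
elim: k u => [|k IHk] u; first by case.
by move=> [uc ud]; split=> // i; have [d1 d2] := ud i; split=> //; exact: IHk.
Qed.

Lemma Ck_fun_le n j k (U : set 'rV[R]_n) u : (j <= k)%N -> Ck_fun k U u -> Ck_fun j U u.
Proof.
move=> jk; rewrite -(subnK jk); elim: (k - j)%N => [//|l IHl] H.
by apply: IHl; apply: Ck_funW.
Qed.

Lemma Ck_on_coord n m k (U : set 'rV[R]_n) (f : 'rV[R]_n -> 'rV[R]_m) : open U ->
  Ck_on k U f <-> forall j, Ck_fun k U (fun x => f x ord0 j).
Proof.
move=> oU.
have contP (h : 'rV[R]_n -> 'rV[R]_m) :
    continuous_on U h <-> forall j, continuous_on U (fun x => h x ord0 j).
  split=> [hc j x Ux|hc x Ux].
    exact: continuous_coord (hc x Ux).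
  apply/continuous_rVP => e e0.
  have H j := (continuous_rVP _ _).1 (hc j x Ux) _ e0.
  have : \forall y \near x, forall j, `|h x ord0 j - h y ord0 j| <= e.
    apply: (@filter_forall _ _ (fun (j : 'I_m) (y : 'rV[R]_n) =>
      `|h x ord0 j - h y ord0 j| <= e) (nbhs x) _) => j.
    by apply/near_addP; exact: H.
  move=> /near_addP[d d0 dP]; exists d => // k' kd.
  apply/rV_norm_leP => [|j]; first exact: ltW.
  by rewrite !mxE; exact: dP.
have derP (h : 'rV[R]_n -> 'rV[R]_m) e :
    (forall x, U x -> derivable h x e) <->
    forall j, forall x, U x -> derivable (fun x => h x ord0 j) x e.
  split=> [hd j x Ux|hd x Ux]; first exact: (derivable_mxP _ _ _).1 (hd x Ux) ord0 j.
  by apply/derivable_mxP => i j; rewrite ord1; exact: hd.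
elim: k f => [|k IHk] f /=; first exact: contP.
split=> [[fc fd] j|H]; last first.
  split; first by apply/contP => j; case: (H j).
  move=> i; have fd : forall x, U x -> derivable f x (delta_mx ord0 i).
    by apply/derP => j; case: (H j) => _ /(_ i)[].
  split=> //; apply/IHk => j; case: (H j) => _ /(_ i)[_].
  by apply: eq_Ck_fun => // x Ux; rewrite derive_mx ?mxE//; exact: fd.
split; first by move: j; apply/contP.
move=> i; have [d1 d2] := fd i; split; first by move: j; apply/derP.
have /IHk /(_ j) := d2.
by apply: eq_Ck_fun => // x Ux; rewrite derive_mx ?mxE//; exact: d1.
Qed.

Section algebra.
Context {n : nat} {U : set 'rV[R]_n}.
Hypothesis oU : open U.
Implicit Types u v : 'rV[R]_n -> R.

Lemma Ck_fun_cst k (c : R) : Ck_fun k U (fun=> c).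
Proof.
elim: k c => [|k IHk] c /=; first by move=> x _; exact: cst_continuous.
split=> [x _|i]; first exact: cst_continuous.
split=> [x _|]; first exact: derivable_cst.
by apply: (@eq_Ck_fun _ _ _ (fun=> 0)) => // x _; rewrite derive_cst.
Qed.

Lemma Ck_funD k u v : Ck_fun k U u -> Ck_fun k U v -> Ck_fun k U (fun x => u x + v x).
Proof.
elim: k u v => [|k IHk] u v /=.
  by move=> uc vc x Ux; apply: continuousD; [exact: uc|exact: vc].
move=> [uc ud] [vc vd]; split.
  by move=> x Ux; apply: continuousD; [exact: uc|exact: vc].
move=> i; have [u1 u2] := ud i; have [v1 v2] := vd i; split=> [x Ux|].
  by apply: derivableD; [exact: u1|exact: v1].
apply: eq_Ck_fun oU _ (IHk _ _ u2 v2) => x Ux.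
exact: esym (deriveD (u1 x Ux) (v1 x Ux)).
Qed.

Lemma Ck_funM k u v : Ck_fun k U u -> Ck_fun k U v -> Ck_fun k U (fun x => u x * v x).
Proof.
elim: k u v => [|k IHk] u v.
  by move=> uc vc x Ux; apply: continuousM; [exact: uc|exact: vc].
move=> uk vk; split.
  by move=> x Ux; apply: continuousM; [exact: (Ck_fun_continuous uk)|exact: (Ck_fun_continuous vk)].
have uk' := Ck_funW uk; have vk' := Ck_funW vk.
move=> i; have [u1 u2] := uk.2 i; have [v1 v2] := vk.2 i; split=> [x Ux|].
  by apply: derivableM; [exact: u1|exact: v1].
apply: eq_Ck_fun oU _ (Ck_funD (IHk _ _ uk' v2) (IHk _ _ vk' u2)) => x Ux.
exact: esym (deriveM (u1 x Ux) (v1 x Ux)).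
Qed.

Lemma Ck_funV k u : (forall x, U x -> u x != 0) -> Ck_fun k U u ->
  Ck_fun k U (fun x => (u x)^-1).
Proof.
move=> u0; elim: k => [|k IHk].
  by move=> uc x Ux; apply: continuousV; [exact: u0|exact: uc].
move=> uk; split.
  by move=> x Ux; apply: continuousV; [exact: u0|exact: (Ck_fun_continuous uk)].
have iu := IHk (Ck_funW uk).
move=> i; have [u1 u2] := uk.2 i; split=> [x Ux|].
  by apply: derivableV; [exact: u0|exact: u1].
apply: eq_Ck_fun oU _ (Ck_funM (Ck_fun_cst k (-1)) (Ck_funM (Ck_funM iu iu) u2)) => x Ux.
rewrite deriveV ?u0//; last exact: u1.
by rewrite mulN1r scaleNr -exprVn expr2.
Qed.

Lemma Ck_fun_sum k (I : Type) (r : seq I) (P : pred I) (u : I -> 'rV[R]_n -> R) :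
  (forall i, P i -> Ck_fun k U (u i)) -> Ck_fun k U (fun x => \sum_(i <- r | P i) u i x).
Proof.
move=> uk; elim: r => [|i r IHr].
  by apply: eq_Ck_fun oU _ (Ck_fun_cst k 0) => x _; rewrite big_nil.
case: (boolP (P i)) => [Pi|Pi].
  by apply: eq_Ck_fun oU _ (Ck_funD (uk i Pi) IHr) => x _; rewrite big_cons Pi.
by apply: eq_Ck_fun oU _ IHr => x _; rewrite big_cons (negbTE Pi).
Qed.

Lemma Ck_fun_prod k (I : Type) (r : seq I) (P : pred I) (u : I -> 'rV[R]_n -> R) :
  (forall i, P i -> Ck_fun k U (u i)) -> Ck_fun k U (fun x => \prod_(i <- r | P i) u i x).
Proof.
move=> uk; elim: r => [|i r IHr].
  by apply: eq_Ck_fun oU _ (Ck_fun_cst k 1) => x _; rewrite big_nil.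
case: (boolP (P i)) => [Pi|Pi].
  by apply: eq_Ck_fun oU _ (Ck_funM (uk i Pi) IHr) => x _; rewrite big_cons Pi.
by apply: eq_Ck_fun oU _ IHr => x _; rewrite big_cons (negbTE Pi).
Qed.

Lemma Ck_fun_det k l (A : 'rV[R]_n -> 'M[R]_l) :
  (forall i j, Ck_fun k U (fun x => A x i j)) -> Ck_fun k U (fun x => \det (A x)).
Proof.
move=> Ak; apply: Ck_fun_sum => s _; apply: Ck_funM; first exact: Ck_fun_cst.
by apply: Ck_fun_prod => i _.
Qed.

(** Cramer's rule: each entry is a cofactor divided by the determinant. *)
Lemma Ck_fun_invmx k l (A : 'rV[R]_n -> 'M[R]_l) i j :
  (forall x, U x -> A x \in unitmx) ->
  (forall i j, Ck_fun k U (fun x => A x i j)) -> Ck_fun k U (fun x => invmx (A x) i j).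
Proof.
move=> Au Ak.
have adj : Ck_fun k U (fun x => (-1) ^+ (j + i) * \det (row' j (col' i (A x)))).
  apply: Ck_funM; first exact: Ck_fun_cst.
  apply: Ck_fun_det => i' j'.
  by apply: eq_Ck_fun oU _ (Ak (lift j i') (lift i j')) => x _; rewrite !mxE.
have det0 x : U x -> \det (A x) != 0 by move=> /Au; rewrite unitmxE unitfE.
apply: eq_Ck_fun oU _ (Ck_funM (Ck_funV det0 (Ck_fun_det Ak)) adj) => x Ux.
by rewrite /invmx Au// !mxE.
Qed.

End algebra.

Definition jacobi {n m} (f : 'rV[R]_n -> 'rV[R]_m) x : 'M[R]_(n, m) :=
  \matrix_(i, j) 'D_(delta_mx ord0 i) (fun y => f y ord0 j) x.

Lemma C1_fderiv n m (U : set 'rV[R]_n) (f : 'rV[R]_n -> 'rV[R]_m) x : open U -> U x ->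
  (forall j, Ck_fun 1 U (fun x => f x ord0 j)) -> fderiv f x (jacobi f x).
Proof.
move=> oU Ux fk e e0.
have nU := open_nbhs_nbhs (conj oU Ux).
have xhx h : x + h - x = h by rewrite addrAC subrr add0r.
have H j : exists2 d, 0 < d & forall h, `|h| <= d ->
    `|f (x + h) ord0 j - f x ord0 j - \sum_i h ord0 i * 'D_(delta_mx ord0 i) (fun y => f y ord0 j) x| <= e * `|h|.
  apply: (partials_fderiv (u := fun y => f y ord0 j)) => //.
    by apply: filterS nU => y Uy i; case: (fk j) => _ /(_ i)[d1 _]; exact: d1.
  by move=> i; case: (fk j) => _ /(_ i)[_]; apply.
have : \forall y \near x, forall j, 
    `|f y ord0 j - f x ord0 j - \sum_i (y - x) ord0 i * 'D_(delta_mx ord0 i) (fun y => f y ord0 j) x| <= e * `|y - x|.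
  apply: (@filter_forall _ _ (fun (j : 'I_m) (y : 'rV[R]_n) => 
    `|f y ord0 j - f x ord0 j - \sum_i (y - x) ord0 i * 'D_(delta_mx ord0 i) (fun y => f y ord0 j) x| <= e * `|y - x|) (nbhs x) _) => j.
  apply/near_addP; have [d d0 dP] := H j; exists d => // h /dP.
  by rewrite xhx.
move=> /near_addP[d d0 dP]; exists d => // h hd.
apply/rV_norm_leP => [|j]; first by rewrite mulr_ge0// ltW.
have := dP h hd j; rewrite xhx !mxE.
by under [X in _ -> `|_ - X| <= _]eq_bigr do rewrite mxE.
Qed.

(** Induction on [k]: a partial derivative of the composite is a sum of products of partials of [g]
    with partials of [phi] composed with [g], and the latter partials have one order less. *)
Lemma Ck_fun_comp n m k (U : set 'rV[R]_m) (V : set 'rV[R]_n)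
    (g : 'rV[R]_n -> 'rV[R]_m) (phi : 'rV[R]_m -> R) :
  open U -> open V -> (forall y, V y -> U (g y)) ->
  Ck_fun k U phi -> (forall j, Ck_fun k V (fun y => g y ord0 j)) ->
  continuous_on V g -> Ck_fun k V (phi \o g).
Proof.
move=> oU oV gVU; elim: k phi => [|k IHk] phi pk gk gc.
  by move=> y Vy; exact: continuous_rV_comp (gc y Vy) (pk _ (gVU _ Vy)).
split.
  by move=> y Vy; exact: continuous_rV_comp (gc y Vy) (Ck_fun_continuous pk (gVU _ Vy)).
(* [phi] is wrapped as a row of length 1, the form in which [fderiv_comp] supplies the chain
   rule. *)
pose P (x : 'rV[R]_m) : 'rV[R]_1 := \row__ phi x.
have P1 : forall j, Ck_fun 1 U (fun x => P x ord0 j).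
  move=> j; apply: eq_Ck_fun oU _ (Ck_fun_le (ltn0Sn k) pk) => x _.
  by rewrite mxE.
have dP y : V y -> fderiv (P \o g) y (jacobi g y *m jacobi P (g y)).
  move=> Vy; apply: fderiv_comp.
    by apply: C1_fderiv oV Vy _ => j; exact: Ck_fun_le (gk j).
  by apply: C1_fderiv oU (gVU _ Vy) P1.
have PE : (fun y => (P \o g) y ord0 ord0) = phi \o g.
  by apply/funext => y; rewrite /= mxE.
move=> i; split=> [y Vy|].
  have [Hd _] := fderiv_is_derive (delta_mx ord0 i) (dP y Vy).
  by have := (derivable_mxP _ _ _).1 Hd ord0 ord0; rewrite PE.
have S : Ck_fun k V (fun y => \sum_j 'D_(delta_mx ord0 i) (fun y => g y ord0 j) y *
    ('D_(delta_mx ord0 j) phi \o g) y).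
  apply: (Ck_fun_sum oV) => j _; apply: (Ck_funM oV).
    by case: (gk j) => _ /(_ i)[].
  apply: IHk => //; first by case: pk => _ /(_ j)[].
  by move=> l; exact: Ck_funW.
apply: eq_Ck_fun oV _ S => y Vy.
have [Hd Hv] := fderiv_is_derive (delta_mx ord0 i) (dP y Vy).
rewrite -PE.
have -> : 'D_(delta_mx ord0 i) (fun y => (P \o g) y ord0 ord0) y =
    ('D_(delta_mx ord0 i) (P \o g) y) ord0 ord0.
  by rewrite derive_mx ?mxE//; exact: Hd.
rewrite Hv mulmxA -rowE mxE.
apply: eq_bigr => j _; rewrite !mxE; congr (_ * _).
by congr ('D__ _ _); apply/funext => z; rewrite mxE.
Qed.

(** Bootstrapping: the derivative of [g] is the inverse of the Jacobian of [f] taken at [g]. If [g]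
    is C^l with l <= k, this expression is C^l, so [g] is C^(l+1). *)
Lemma Ck_inverse n k (U V : set 'rV[R]_n) (f g : 'rV[R]_n -> 'rV[R]_n) :
  open U -> open V -> (forall y, V y -> U (g y)) -> continuous_on V g ->
  (forall y, V y -> f (g y) = y) ->
  (forall y, V y -> jacobi f (g y) \in unitmx) ->
  Ck_on k.+1 U f -> Ck_on k.+1 V g.
Proof.
move=> oU oV gVU gc fg Ju /(Ck_on_coord _ _ oU) fk; apply/Ck_on_coord => //.
have gd y : V y -> fderiv g y (invmx (jacobi f (g y))).
  move=> Vy; apply: (@fderiv_inverse _ _ f) => //; first exact: gc.
  - by apply: filterS (open_nbhs_nbhs (conj oV Vy)).
  - by apply: C1_fderiv oU (gVU _ Vy) _ => j; exact: Ck_fun_le (fk j).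
  - exact: Ju.
have gcj j : continuous_on V (fun y => g y ord0 j).
  by move=> y Vy; exact: continuous_coord (gc y Vy).
suff H l : (l <= k.+1)%N -> forall j, Ck_fun l V (fun y => g y ord0 j) by exact: H.
elim: l => [_ j|l IHl lk j]; first exact: gcj.
have {}IHl := IHl (ltnW lk).
have Jk i i' : Ck_fun l V (fun y => jacobi f (g y) i i').
  have : Ck_fun l V ('D_(delta_mx ord0 i) (fun x => f x ord0 i') \o g).
    apply: (Ck_fun_comp oU oV gVU) => //.
    by case: (fk i') => _ /(_ i)[_]; exact: Ck_fun_le.
  by apply: eq_Ck_fun oV _ => y _; rewrite mxE.
split; first exact: gcj.
move=> i; split=> [y Vy|].
  have [Hd _] := fderiv_is_derive (delta_mx ord0 i) (gd y Vy).
  exact: (derivable_mxP _ _ _).1 Hd ord0 j.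
apply: eq_Ck_fun oV _ (Ck_fun_invmx oV i j Ju Jk) => y Vy.
have [Hd Hv] := fderiv_is_derive (delta_mx ord0 i) (gd y Vy).
have -> : 'D_(delta_mx ord0 i) (fun y => g y ord0 j) y =
    ('D_(delta_mx ord0 i) g y) ord0 j.
  by rewrite derive_mx ?mxE//; exact: Hd.
by rewrite Hv -rowE mxE.
Qed.

End Ck_scalar.

(** * Invertibility of the Jacobian and conclusion *)

Lemma open_preimage_on (R : realType) n m (V : set 'rV[R]_n) (U : set 'rV[R]_m)
    (g : 'rV[R]_n -> 'rV[R]_m) :
  open V -> open U -> continuous_on V g -> open (V `&` g @^-1` U).
Proof.
move=> oV oU gc; rewrite openE => y [Vy Uy]; apply: filterI.
  exact: (open_nbhs_nbhs (conj oV Vy)).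
exact: (gc y Vy _ (open_nbhs_nbhs (conj oU Uy))).
Qed.

Lemma fderiv_line (R : realType) n (y v : 'rV[R]_n) :
  fderiv (fun s : 'rV[R]_1 => y + s ord0 ord0 *: v) 0 v.
Proof.
move=> e e0; exists 1 => // h _.
rewrite (_ : _ - _ = 0) ?normr0 ?mulr_ge0 ?(ltW e0)//.
apply/rowP => j; rewrite !mxE big_ord1 !mul0r !add0r addr0.
by rewrite addrAC subrr add0r subrr.
Qed.

(* Differentiating [f (g (y + s *: e_i)) = y + s *: e_i] at [s = 0] produces a
   left inverse of [J], row by row. *)
Lemma fderiv_unitmx (R : realType) n (f g : 'rV[R]_n -> 'rV[R]_n)
    (y : 'rV[R]_n) J :
  (\forall z \near y, f (g z) = z) ->
  (forall v, real_analytic_at (fun s : 'rV[R]_1 => g (y + s ord0 ord0 *: v)) 0) ->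
  fderiv f (g y) J -> J \in unitmx.
Proof.
move=> fg ga fJ.
have /choice[A AP] : forall i : 'I_n, exists A : 'rV[R]_n, A *m J = delta_mx ord0 i.
  move=> i; have [A gA] := analytic_fderiv (ga (delta_mx ord0 i)); exists A.
  have y0 : y + (0 : 'rV[R]_1) ord0 ord0 *: delta_mx ord0 i = y.
    by rewrite mxE scale0r addr0.
  apply: (fderiv_unique _ (fderiv_line y (delta_mx ord0 i))).
  have := fderiv_comp gA (B := J); rewrite y0 => /(_ _ fJ); apply: fderiv_near_eq.
  have lc := analytic_continuous (line_analytic y (delta_mx ord0 i)).
  rewrite /prop_for /continuous_at y0 in lc.
  exact: (lc _ fg).
suff : (\matrix_i A i) *m J = 1%:M by move/mulmx1_unit => -[].
by apply/row_matrixP => i; rewrite row_mul rowK AP rowE mulmx1.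
Qed.

Theorem corollary1p2 (R : realType) (n : nat) (f g : 'rV[R]_n -> 'rV[R]_n)
  (k : smoothness) (k_pos : k <> Cfin 0)
  (fg : homeomorphism_germ f g) (f_semialg : semialgebraic_germ f)
  (g_blow : blow_analytic_germ g) :
  C_germ k f -> C_germ k g.
Proof.
move=> [Uf [oUf Uf0 fk]].
have [f0 [U [V [[oU oV U0 V0] fU gV fc gc]]]] := fg.
have [Vb [oVb [Vb0 gb]]] := g_blow.
(* On [W] all representatives are usable at once: [f] inverts [g], the values of [g] lie where [f]
   is C^k and where [g] inverts [f], and [g] is blow-analytic around each point. *)
pose W := V `&` g @^-1` (U `&` Uf) `&` Vb.
have oW : open W by apply: openI => //; apply: open_preimage_on => //; exact: openI.
have g0 : g 0 = 0 by have [_] := fU _ U0; rewrite f0.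
have W0 : W 0 by split=> //; split=> //; rewrite /= g0.
have gW y : W y -> Uf (g y) by move=> [[_ []]].
have fgW y : W y -> f (g y) = y by move=> [[/gV[]]].
have gcW : continuous_on W g by move=> y [[Vy _] _]; exact: gc.
have unit y J : W y -> fderiv f (g y) J -> J \in unitmx.
  move=> Wy; apply: fderiv_unitmx => [|v].
    by apply: (filterS fgW (open_nbhs_nbhs (conj oW Wy))).
  by apply: (blow_analytic_line _ _ gb); case: Wy.
have finite l : Ck_on l.+1 Uf f -> Ck_on l.+1 W g.
  move=> fl; apply: (Ck_inverse oUf oW gW gcW fgW _ fl) => y Wy.
  apply: (unit y) => //; apply: (C1_fderiv oUf (gW _ Wy)) => j.
  apply: (@Ck_fun_le _ _ 1 l.+1) => //.
  exact: (Ck_on_coord _ _ oUf).1 fl j.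
exists W; split=> //; case: k k_pos fk => [[//|l] _|_|_] fk /=.
- exact: finite.
(* [finite] concerns positive orders, so order [l] is deduced from order [l.+1]. *)
- move=> l; apply/Ck_on_coord => // j; apply: Ck_funW; move: j.
  by apply/Ck_on_coord => //; exact: finite.
(* [analytic_inverse] gives analyticity at points of the form [f x]; here [x] is [g y]. *)
- move=> y Wy; rewrite -(fgW _ Wy); apply: analytic_inverse.
  + exact: fk (gW _ Wy).
  + by move=> J; exact: unit.
  + have Ugy : U (g y) by case: Wy => [[_ []]].
    apply: filterS (open_nbhs_nbhs (conj oU Ugy)) => x Ux.
    by case: (fU _ Ux).
Qed.
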